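(* Let $a\geq 1$ and $k\geq 0$ be integers, let $n=a+k$, and let $A$ be an $n\times n$ real matrix. If $A\in\operatorname{TP}_{k+1}(n)$, then $$\phi^{(a,1^k)}[A]\geq 0.$$
   Context: $\mathfrak{S}_n$ is the symmetric group on $\{1,\dots,n\}$. For a real-valued class function $f$ on $\mathfrak{S}_n$ and a real $n\times n$ matrix $A=(a_{ij})$, set $$f[A]=\sum_{\sigma\in\mathfrak{S}_n}f(\sigma)\prod_{i=1}^n a_{i\sigma(i)}.$$ On real-valued class functions use the inner product $\langle f,g\rangle=\frac1{n!}\sum_{\sigma\in\mathfrak{S}_n}f(\sigma)g(\sigma^{-1})$. For a partition $\lambda=(\lambda_1,\dots,\lambda_\ell)\vdash n$, let $\mathfrak{S}_\lambda\cong\mathfrak{S}_{\lambda_1}\times\cdots\times\mathfrak{S}_{\lambda_\ell}$ be the standard Young subgroup and $\eta^\lambda=\operatorname{Ind}_{\mathfrak{S}_\lambda}^{\mathfrak{S}_n}\mathbf 1$ the character induced from the trivial character. The characters $\eta^\lambda$ ($\lambda\vdash n$) form a basis of the space of real-valued class functions on $\mathfrak{S}_n$; the class functions $\phi^\lambda$ ($\lambda\vdash n$) are the dual basis, characterized by $\langle\eta^\mu,\phi^\lambda\rangle=\delta_{\lambda\mu}$ for all $\lambda,\mu\vdash n$. The expression $\phi^\lambda[A]$ is called a monomial immanant. $(a,1^k)$ denotes the hook partition of $n=a+k$ with one part equal to $a$ followed by $k$ parts equal to $1$. For $r\ge1$, $\operatorname{TP}_r(n)$ is the set of real $n\times n$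 matrices all of whose minors of order at most $r$ are nonnegative, where a minor is the determinant of a square submatrix with row indices and column indices each taken in increasing order (zero minors are allowed; if $r>n$ only existing minors are considered). *)

(* Defs.v *)
From HB Require Import structures.
From mathcomp Require Import all_boot all_order all_algebra all_fingroup.
From mathcomp Require Import all_solvable all_field all_character.
From mathcomp Require Import reals.
Set Implicit Arguments.
Unset Strict Implicit.
Unset Printing Implicit Defensive.
Import Order.TTheory GRing.Theory Num.Theory.
Local Open Scope ring_scope.

Definition is_partition (n : nat) (lam : seq nat) : bool :=
  [&& sumn lam == n, sorted geq lam & all (leq 1) lam].

Definition hook (a k : nat) : seq nat := a :: nseq k 1%N.

(* [reshape_index lam i] is the index of the block of consecutive integers, of
   sizes lam_1, lam_2, ..., that contains i. *)
Definition young (n : nat) (lam : seq nat) : {set 'S_n} :=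
  [set s : 'S_n | [forall i, reshape_index lam (s i) == reshape_index lam i]].

Lemma young_group_set n lam : group_set (young n lam).
Proof.
apply/group_setP; split=> [|s t].
  by rewrite inE; apply/forallP=> i; rewrite perm1.
rewrite !inE => /forallP hs /forallP ht; apply/forallP=> i.
by rewrite permM (eqP (ht _)) (eqP (hs _)).
Qed.

Canonical young_group n lam := Group (young_group_set n lam).

Definition eta_cf (n : nat) (lam : seq nat) : 'CF([set: 'S_n]) :=
  'Ind[[set: 'S_n]] (1 : 'CF(young n lam)).

Lemma eta_cf_nat n lam (s : 'S_n) : eta_cf n lam s \in Num.nat.
Proof.
have val t : (1 : 'CF(young n lam)) t = (t \in young n lam)%:R.
  exact: cfun1E.
rewrite natrEint; apply/andP; split.
  apply: Cint_rat_Aint; last by rewrite Aint_char // cfInd_char // cfun1_char.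
  rewrite cfIndE ?subsetT // rpredM // ?rpredV ?rpred_nat // rpred_sum // => t _.
  by rewrite val rpred_nat.
rewrite cfIndE ?subsetT // mulr_ge0 ?invr_ge0 ?ler0n // sumr_ge0 // => t _.
by rewrite val ler0n.
Qed.

(* Characters in the library take values in [algC]; the values of [eta_cf] are
   natural numbers, so [Num.truncn] loses nothing (see [etaE]). *)
Definition eta (R : realType) (n : nat) (lam : seq nat) (s : 'S_n) : R :=
  (Num.truncn (eta_cf n lam s))%:R.

Lemma etaE n lam (s : 'S_n) : (Num.truncn (eta_cf n lam s))%:R = eta_cf n lam s.
Proof. by rewrite truncnK // eta_cf_nat. Qed.

Definition class_function (R : realType) (n : nat) (f : 'S_n -> R) : Prop :=
  forall s t : 'S_n, f (s ^ t)%g = f s.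

Definition inner (R : realType) (n : nat) (f g : 'S_n -> R) : R :=
  (n`!)%:R^-1 * \sum_(s : 'S_n) f s * g (s^-1)%g.

(* Only the values of [phi] at partitions of n are constrained. *)
Definition is_dual_basis (R : realType) (n : nat)
    (phi : seq nat -> 'S_n -> R) : Prop :=
  (forall lam, is_partition n lam -> class_function (phi lam)) /\
  (forall lam mu, is_partition n lam -> is_partition n mu ->
     inner (eta R mu) (phi lam) = (lam == mu)%:R).

Definition immanant (R : realType) (n : nat) (f : 'S_n -> R) (A : 'M[R]_n) : R :=
  \sum_(s : 'S_n) f s * \prod_(i < n) A i (s i).

Definition TP (R : realType) (n r : nat) (A : 'M[R]_n) : Prop :=
  forall (m : nat) (I J : 'I_m -> 'I_n), (m <= r)%N ->
    {homo I : i j / (i < j)%N} -> {homo J : i j / (i < j)%N} ->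
    0 <= \det (mxsub I J A).

(* Main.v *)
Require Import Defs.
From mathcomp Require Import all_boot all_order all_algebra all_fingroup.
From mathcomp Require Import algC classfun.
From mathcomp Require Import reals.
From mathcomp Require Import ring lra zify.
Import Order.TTheory GRing.Theory Num.Theory.
Local Open Scope ring_scope.
Set Implicit Arguments.
Unset Strict Implicit.
Unset Printing Implicit Defensive.

(** Write m_lambda for the monomial symmetric function; the dual basis element
    phi^lambda is the class function with Frobenius characteristic m_lambda.
    For a >= 2 one has m_(a,1^k) = sum_j (-1)^j p_(a+j) e_(k-j). Reading p_b as a
    sum over b-cycles and e_c as a determinant, and recognizing the Laplace
    expansion of a minor of order k + 1 in the alternating sum, one finds that
    the monomial immanant of the hook is, up to a positive factor, the cycle sum
      F = sum A(y_1,y_2) ... A(y_(a-1),y_a) * det A[y_a, T ; y_1, T]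
    over all arrangements (T, y_1, ..., y_a) of the indices, where T has k
    elements ([cycle_term], [immanant_hook_function]). The case a = 1 fits in:
    there F is a multiple of the determinant.

    That F really belongs to phi^(a,1^k) is seen without symmetric functions.
    The class function [hook_function] has F as its immanant, by the Leibniz
    formula for a matrix in which the rows y_1, ..., y_(a-1) keep only the entry
    in the column of the next y. By Frobenius reciprocity its pairing with
    eta^mu is an average over a Young subgroup, hence the value of F at the 0-1
    matrix of the blocks of mu; there each term is 0 or 1, and a nonzero term
    forces mu = (a,1^k) ([cycle_term_blocks_hook], [hook_blocks_gt0]). Since a
    class function is determined by its sums over the Young subgroups
    ([class_function_eq0]), [hook_function] is a positive multiple of phi
    ([hook_function_dual]).

    The terms of F have signs: the minor det A[y_a, T ; y_1, T] is only up to sign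
    a minor with increasing indices. Positivity of the sum ([psum_cycle_ge0]) is
    proved by induction on the number of indices, removing the smallest one, b.

    - If b lies on the cycle, cut the cycle there. This gives a sum over walks
      from a root to itself ([walk_term]), the root being a row and a column that
      precede all other indices. Relabelling shows that the step of the walk
      which is replaced by a minor may be moved along the walk without changing
      the sum ([psum_walk_shift]); it is put right after the first vertex.
    - If b lies in T, pivot on it: the minor becomes one of the Schur complement
      of A at b, whose minors of order k are nonnegative. The matrix A is the
      Schur complement plus a rank one matrix; splitting the path at its first
      and last rank one steps leaves a cycle sum or rooted walk sums for the
      Schur complement, with k - 1 in place of k, times path weights.

    Rooted walk sums are nonnegative for the same reasons ([psum_walk_ge0]). With
    b the smallest index: if b is the first vertex, the root row is replaced by
    row b; if b comes later, the root column is replaced by column b and a path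
    weight splits off; if b lies in T, one passes to the Schur complement, where
    the old root row still has the required minors by Fischer's inequality
    ([fischer], [bordered_schur_tp]). The shortest walks are covered by Fischer's
    inequality as well ([psum_walk_base]). Everywhere minors through both the root
    row and the root column are avoided, as their sign is not controlled. *)

(** * Minors indexed by lists of rows and columns *)

Definition minor (R : comNzRingType) (I : Type) (x0 : I) (B : I -> I -> R)
    (X Z : seq I) : R :=
  \det (\matrix_(i < size X, j < size X) B (nth x0 X i) (nth x0 Z j)).

Section Minors.
Variables (R : comNzRingType) (I : eqType) (x0 : I).
Implicit Types (B C : I -> I -> R) (X Z T U : seq I).
Local Notation minor := (minor x0).

Lemma minorE n B X Z : size X = n ->
  minor B X Z = \det (\matrix_(i < n, j < n) B (nth x0 X i) (nth x0 Z j)).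
Proof. by move=> <-. Qed.

Lemma minor1 B x z : minor B [:: x] [:: z] = B x z.
Proof. by rewrite /minor det_mx11 mxE. Qed.

Lemma minor_ext B C X Z : size Z = size X ->
  {in X & Z, B =2 C} -> minor B X Z = minor C X Z.
Proof.
move=> eqZX eqBC; congr (\det _); apply/matrixP=> i j; rewrite !mxE.
by apply: eqBC; apply: mem_nth; rewrite ?eqZX.
Qed.

Lemma minor_tr B X Z : size Z = size X ->
  minor B X Z = minor (fun i j => B j i) Z X.
Proof.
move=> eqZX; rewrite (minorE _ _ eqZX) /minor -det_tr; congr (\det _).
by apply/matrixP=> i j; rewrite !mxE.
Qed.

Lemma minor_move_row B X1 x X2 Z :
  minor B (X1 ++ x :: X2) Z = (-1) ^+ size X1 * minor B (x :: X1 ++ X2) Z.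
Proof.
set n := (size X1 + size X2)%N.
have sz1 : size (X1 ++ x :: X2) = n.+1 by rewrite size_cat /= addnS.
have sz2 : size (x :: X1 ++ X2) = n.+1 by rewrite /= size_cat.
have lt1 : (size X1 < n.+1)%N by rewrite ltnS leq_addr.
rewrite (minorE _ _ sz1) (minorE _ _ sz2); set M := \matrix_(i, j) _.
set N := \matrix_(i, j) _; set i0 := Ordinal lt1.
rewrite (expand_det_row M i0) (expand_det_row N ord0) mulr_sumr.
apply: eq_bigr => j _; rewrite !mxE /= nth_cat ltnn subnn /= [RHS]mulrCA; congr (_ * _).
rewrite /cofactor exprD -mulrA add0n; congr (_ * (_ * \det _)).
apply/matrixP=> i l; rewrite !mxE; congr (B _ _); rewrite /=.
rewrite !nth_cat add0n /bump; case: (leqP (size X1) i) => lei /=.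
  by rewrite add1n ltnNge leqW //= subSn.
by rewrite add0n lei.
Qed.

Lemma minor_move_col B X Z1 z Z2 : size X = size (Z1 ++ z :: Z2) ->
  minor B X (Z1 ++ z :: Z2) = (-1) ^+ size Z1 * minor B X (z :: Z1 ++ Z2).
Proof.
move=> szX; have szX' : size (z :: Z1 ++ Z2) = size X.
  by rewrite szX /= !size_cat addnS.
by rewrite minor_tr // minor_move_row [in RHS]minor_tr.
Qed.

Lemma minor_move B X1 x X2 Z1 z Z2 : size X1 = size Z1 -> size X2 = size Z2 ->
  minor B (X1 ++ x :: X2) (Z1 ++ z :: Z2) = minor B (x :: X1 ++ X2) (z :: Z1 ++ Z2).
Proof.
move=> sz1 sz2; rewrite minor_move_row minor_move_col ?sz1; last first.
  by rewrite /= !size_cat /= sz1 sz2 addnS.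
by rewrite mulrA -exprD addnn -mul2n exprM sqrrN !expr1n mul1r.
Qed.

(** Reordering rows and columns simultaneously: the two signs cancel. *)
Lemma minor_perm B V U T T' : size V = size U -> perm_eq T T' ->
  minor B (V ++ T) (U ++ T) = minor B (V ++ T') (U ++ T').
Proof.
elim: T T' V U => [|x T IH] T' V U szVU eqT.
  by move: eqT; rewrite perm_sym => /perm_nilP ->.
have xT' : x \in T' by rewrite -(perm_mem eqT) mem_head.
case/splitPr: xT' eqT => T1 T2 eqT.
have {}eqT : perm_eq T (T1 ++ T2).
  by rewrite -(perm_cons x) (permPl eqT) -cat1s perm_catCA cat1s.
rewrite -!cat_rcons (IH (T1 ++ T2)) ?size_rcons ?szVU //.
rewrite !cat_rcons minor_move // !catA (minor_move _ _ (X1 := V ++ T1)) //.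
by rewrite !size_cat szVU.
Qed.

(** Laplace expansion in a form free of signs: in the t-th term the column [t] of
    the removed entry is the first column of the cofactor, and moving row [t] to
    the front as well absorbs the sign. *)
Lemma minor_expand_row B v u T : uniq T ->
  minor B (v :: T) (u :: T) =
  B v u * minor B T T -
  \sum_(t <- T) B v t * minor B (t :: rem t T) (u :: rem t T).
Proof.
move=> uT; rewrite (minorE (n := (size T).+1)) // (expand_det_row _ ord0).
rewrite big_ord_recl !mxE /= -sumrN (big_nth x0) big_mkord; congr (_ * _ + _).
  rewrite /cofactor expr0 mul1r; congr (\det _).
  by apply/matrixP=> i j; rewrite !mxE.
apply: eq_bigr => i _; rewrite !mxE /= -mulrN; congr (_ * _).
set t := nth x0 T i.
have lti := ltn_ord i.
have defT : T = take i T ++ t :: drop i.+1 T.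
  by rewrite -drop_nth // cat_take_drop.
have remT : rem t T = take i T ++ drop i.+1 T.
  have ti : index t T = i by rewrite index_uniq.
  by rewrite remE ti.
have szT1 : size (take i T) = i by rewrite size_takel // ltnW.
have := minor_move_row B (take i T) t (drop i.+1 T) (u :: rem t T).
rewrite -defT -remT szT1 => /(congr1 ( *%R ((-1) ^+ i))).
rewrite mulrA -exprD addnn -mul2n exprM sqrrN !expr1n mul1r => <-.
rewrite /cofactor add0n lift0 exprS mulN1r mulNr; congr (- (_ * \det _)).
apply/matrixP=> r j; rewrite !mxE; congr (B _ _).
rewrite remT; case: j => [[|j] ltj] /=; rewrite /bump /= ?add1n //=.
rewrite ltnS nth_cat szT1; case: (leqP i j) => leij /=.
  by rewrite nth_drop addSn subnKC.
by rewrite nth_take.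
Qed.

Lemma minor_expand_col B v u T : uniq T ->
  minor B (v :: T) (u :: T) =
  B v u * minor B T T -
  \sum_(t <- T) minor B (v :: rem t T) (t :: rem t T) * B t u.
Proof.
move=> uT; rewrite minor_tr // minor_expand_row // -(minor_tr _ (X := T)) //.
congr (_ - _); apply: eq_bigr => t _.
by rewrite mulrC -(minor_tr _ (X := v :: _)).
Qed.

Lemma minor_row0 B X Z x : x \in X -> size Z = size X ->
  {in Z, forall z, B x z = 0} -> minor B X Z = 0.
Proof.
move=> xX szZ Bx0; have lti : (index x X < size X)%N by rewrite index_mem.
rewrite /minor (expand_det_row _ (Ordinal lti)) big1 // => j _.
by rewrite !mxE /= nth_index // Bx0 ?mul0r // mem_nth // szZ.
Qed.

Lemma minor_col0 B X Z z : z \in Z -> size Z = size X ->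
  {in X, forall x, B x z = 0} -> minor B X Z = 0.
Proof. by move=> zZ szZ Bz0; rewrite minor_tr //; apply: minor_row0 zZ _ _. Qed.

Lemma minor_head_col B p q X Z : size Z = size X ->
  {in X, forall x, B x q = 0} -> minor B (p :: X) (q :: Z) = B p q * minor B X Z.
Proof.
move=> szZ Bq0; rewrite (minorE (n := (size X).+1)) // (expand_det_col _ ord0).
rewrite big_ord_recl !mxE /= big1 ?addr0 => [|i _]; last first.
  rewrite [X in X * _]mxE (Bq0 (nth x0 X i)) ?mul0r //.
  exact: mem_nth.
congr (_ * _); rewrite /cofactor expr0 mul1r; congr (\det _).
by apply/matrixP=> i j; rewrite !mxE.
Qed.

Lemma minor_rowop B C (c : I -> R) p X Z : size Z = (size X).+1 ->
  {in Z, forall z, C p z = B p z} ->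
  {in X & Z, forall x z, C x z = B x z - c x * B p z} ->
  minor C (p :: X) Z = minor B (p :: X) Z.
Proof.
move=> szZ Cp CX; set n := size X.
pose M D : 'M[R]_(1 + n) := \matrix_(i, j) D (nth x0 (p :: X) i) (nth x0 Z j).
have Mdet D : minor D (p :: X) Z = \det (M D) by rewrite (minorE (n := n.+1)).
pose L : 'M[R]_(1 + n) :=
  block_mx 1%:M 0 (\col_i - c (nth x0 X i)) 1%:M.
have -> : minor C (p :: X) Z = \det (L *m M B).
  rewrite Mdet; congr (\det _); rewrite -[M B]vsubmxK mul_block_col.
  rewrite !mul1mx mul0mx addr0 -[M C]vsubmxK; congr col_mx.
    apply/matrixP=> i j; rewrite !mxE /= ord1 /= Cp // mem_nth // szZ.
    exact: ltn_ord.
  apply/matrixP=> i j; rewrite !mxE big_ord1 !mxE /=.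
  rewrite CX ?mem_nth ?szZ //; last exact: ltn_ord.
  by rewrite mulNr addrC.
by rewrite det_mulmx det_lblock !det1 !mul1r Mdet.
Qed.

End Minors.


Lemma minor_map (R : comNzRingType) (I J : eqType) (x0 : I) (y0 : J)
    (f g : I -> J) (B : J -> J -> R) (X Z : seq I) : size Z = size X ->
  minor y0 B (map f X) (map g Z) = minor x0 (fun x z => B (f x) (g z)) X Z.
Proof.
move=> szZ; rewrite (@minorE _ _ _ (size X)) ?size_map //; congr (\det _).
by apply/matrixP=> i j; rewrite !mxE !(nth_map x0) ?szZ.
Qed.

(** [C] is the Schur complement: subtracting multiples of row [p] clears column [q]. *)
Lemma minor_schur (F : fieldType) (I : eqType) (x0 : I) (B C : I -> I -> F)
    p q X Z : size Z = size X -> p \notin X -> B p q != 0 ->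
  {in X & Z, forall x z, C x z = B x z - B x q * B p z / B p q} ->
  minor x0 B (p :: X) (q :: Z) = B p q * minor x0 C X Z.
Proof.
move=> szZ pX nz CX.
pose D x z := if x == p then B p z else B x z - B x q / B p q * B p z.
have DX x : x \in X -> (x == p) = false by move=> xX; apply: contraNF pX => /eqP <-.
rewrite -(@minor_rowop _ _ _ _ D (fun x => B x q / B p q)) /= ?szZ //; last 2 first.
- by move=> z _; rewrite /D eqxx.
- by move=> x z xX _; rewrite /D DX.
rewrite minor_head_col // => [|x xX]; last by rewrite /D DX // divfK ?subrr.
rewrite /D eqxx; congr (_ * _); apply: minor_ext => // x z xX zZ.
by rewrite DX // CX // mulrAC.
Qed.

Lemma minor_head_row (R : comNzRingType) (I : eqType) (x0 : I) (B : I -> I -> R)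
    p q X Z : size Z = size X -> {in Z, forall z, B p z = 0} ->
  minor x0 B (p :: X) (q :: Z) = B p q * minor x0 B X Z.
Proof.
move=> szZ Bp0; rewrite minor_tr ?minor_head_col /= ?szZ //.
by rewrite -minor_tr.
Qed.

Lemma minor2 (R : comNzRingType) (I : eqType) (x0 : I) (B : I -> I -> R) i x j z :
  minor x0 B [:: i; x] [:: j; z] = B i j * B x z - B i z * B x j.
Proof.
rewrite (@minorE _ _ _ 2) // (expand_det_row _ ord0) !big_ord_recl big_ord0 addr0.
by rewrite /cofactor !det_mx11 !mxE /= expr0 expr1 mul1r mulN1r mulrN.
Qed.

(** * A Fischer inequality without the corner minors *)

Section Nonneg.
Variable R : realFieldType.
Implicit Types (B C : nat -> nat -> R) (X Z : seq nat).
Local Notation minor := (minor 0%N).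

(** Index 0 plays the part of a root that precedes all other indices, as a row or
    as a column; the minors using both are left out. *)
Definition nonneg_minors r B X Z :=
  [/\ size Z = size X -> (size X <= r)%N -> 0 <= minor B X Z,
      size Z = (size X).+1 -> (size Z <= r)%N -> 0 <= minor B (0%N :: X) Z
    & size X = (size Z).+1 -> (size X <= r)%N -> 0 <= minor B X (0%N :: Z)].

Lemma minor_rcons B X Z x z : size Z = size X ->
  minor B (rcons X x) (rcons Z z) = minor B (x :: X) (z :: Z).
Proof. by move=> szZ; rewrite -!cats1 minor_move // !cats0. Qed.

(** For a totally nonnegative matrix this is Fischer's inequality: the determinant
    is at most the corner entry times the complementary minor, so zeroing the
    corner makes it nonpositive. Pivoting on the last row and column reduces the
    size and can only decrease the corner, and it never needs a minor through the
    corner. *)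
Lemma fischer B X Z : uniq X -> size Z = size X -> 0%N \notin X -> 0%N \notin Z ->
  B 0%N 0%N <= 0 ->
  (forall X' Z', subseq X' X -> subseq Z' Z -> nonneg_minors (size X) B X' Z') ->
  minor B (0%N :: X) (0%N :: Z) <= 0.
Proof.
elim/last_ind: X Z B => [|X x IH] Z B.
  by case: Z => // _ _ _ _ B0 _; rewrite minor1.
case/lastP: Z => [|Z z]; rewrite !size_rcons // rcons_uniq => /andP[xX uX] [szZ].
rewrite !mem_rcons !in_cons !negb_or => /andP[x0 X0] /andP[z0 Z0] B0 hB.
have subX X' : subseq X' X -> subseq X' (rcons X x).
  by move=> sX; apply: subseq_trans sX (subseq_rcons _ _).
have subZ Z' : subseq Z' Z -> subseq Z' (rcons Z z).
  by move=> sZ; apply: subseq_trans sZ (subseq_rcons _ _).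
have subXx X' : subseq X' X -> subseq (rcons X' x) (rcons X x).
  by move=> sX; rewrite -!cats1 cat_subseq.
have subZz Z' : subseq Z' Z -> subseq (rcons Z' z) (rcons Z z).
  by move=> sZ; rewrite -!cats1 cat_subseq.
have -> : minor B (0%N :: rcons X x) (0%N :: rcons Z z) =
          minor B (x :: 0%N :: X) (z :: 0%N :: Z).
  by rewrite -!rcons_cons minor_rcons //= szZ.
have subx : subseq [:: x] (rcons X x) by rewrite sub1seq mem_rcons mem_head.
have subz : subseq [:: z] (rcons Z z) by rewrite sub1seq mem_rcons mem_head.
have p_ge0 : 0 <= B x z.
  have [+ _ _] := hB _ _ subx subz; rewrite minor1; exact.
have Bx_ge0 : 0 <= B x 0%N.
  have [_ _ +] := hB _ _ subx (sub0seq _); rewrite minor1; exact.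
have Bz_ge0 : 0 <= B 0%N z.
  have [_ + _] := hB _ _ (sub0seq _) subz; rewrite minor1; exact.
have hB0 : 0 <= minor B X Z.
  have [+ _ _] := hB _ _ (subX _ (subseq_refl _)) (subZ _ (subseq_refl _)).
  by apply.
have [p0|pn0] := eqVneq (B x z) 0; last first.
  have p_gt0 : 0 < B x z by rewrite lt_def pn0.
  pose C i j := B i j - B i z * B x j / B x z.
  rewrite (@minor_schur _ _ _ _ C) //=; [|by rewrite szZ|]; last first.
    by rewrite in_cons negb_or eq_sym x0.
  rewrite pmulr_rle0 //; apply: IH => //.
    by rewrite /C subr_le0 (le_trans B0) // divr_ge0 // mulr_ge0.
  move=> X' Z' sX sZ; have [h1 h2 h3] := hB _ _ (subXx _ sX) (subZz _ sZ).
  have xX' : x \notin X' by apply: contra xX => /(mem_subseq sX).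
  split=> sz szr.
  - move: h1; rewrite !size_rcons sz minor_rcons // (@minor_schur _ _ _ _ C) //.
    by rewrite pmulr_rge0 //; apply.
  - move: h2; rewrite !size_rcons sz -rcons_cons minor_rcons //=.
    rewrite (@minor_schur _ _ _ _ C) //=; last by rewrite in_cons negb_or eq_sym x0.
    by rewrite pmulr_rge0 //; apply=> //; rewrite -sz.
  - move: h3; rewrite !size_rcons sz -rcons_cons minor_rcons //=.
    rewrite (@minor_schur _ _ _ _ C) //= pmulr_rge0 //; apply=> //.
    by rewrite -sz.
(* A vanishing pivot kills its row or its column, up to the root entries. *)
have sub1 (i : nat) (L : seq nat) l : i \in L -> subseq [:: i; l] (rcons L l).
  by move=> iL; rewrite -cats1 (cat_subseq (s1 := [:: i])) // sub1seq.
have cross i j : 0 <= B i z -> 0 <= B x j -> 0 <= minor B [:: i; x] [:: j; z] ->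
    B i z * B x j = 0.
  rewrite minor2 p0 mulr0 sub0r oppr_ge0 => Bi Bj le0; apply/eqP.
  by rewrite eq_le le0 mulr_ge0.
have Bx_ge j : j \in Z -> 0 <= B x j.
  rewrite -sub1seq => /subZ sj; have [+ _ _] := hB _ _ subx sj.
  by rewrite minor1; apply.
have Bz_ge i : i \in X -> 0 <= B i z.
  rewrite -sub1seq => /subX si; have [+ _ _] := hB _ _ si subz.
  by rewrite minor1; apply.
have sz2 i (L : seq nat) : i \in L -> size L = size X -> (2 <= (size X).+1)%N.
  by case: L => //= a L _ <-.
have [/hasP[j jZ Bj]|/hasPn Bx0] := boolP (has (fun j => B x j != 0) Z).
  rewrite (minor_col0 _ (z := z)) ?mem_head //= ?szZ // => i.
  have Bj_ge := Bx_ge _ jZ.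
  rewrite !in_cons => /or3P[/eqP->//|/eqP->|iX];
    apply: (mulIf Bj); rewrite mul0r; apply: cross => //; try exact: Bz_ge.
    have [_ + _] := hB [:: x] [:: j; z] subx (sub1 _ _ _ jZ).
    by apply=> //; apply: sz2 jZ _.
  have [+ _ _] := hB [:: i; x] [:: j; z] (sub1 _ _ _ iX) (sub1 _ _ _ jZ).
  by apply=> //; apply: sz2 jZ _.
have Bx0' : {in Z, forall j, B x j = 0} by move=> j /Bx0; rewrite negbK => /eqP.
have [/hasP[i iX Bi]|/hasPn Bz0] := boolP (has (fun i => B i z != 0) X).
  rewrite (minor_row0 _ (x := x)) ?mem_head //= ?szZ // => j.
  rewrite !in_cons => /or3P[/eqP->//|/eqP->|jZ]; last exact: Bx0'.
  apply: (mulfI Bi); rewrite mulr0; apply: cross => //; first exact: Bz_ge.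
  have [_ _ +] := hB [:: i; x] [:: z] (sub1 _ _ _ iX) subz.
  by apply=> //; apply: sz2 iX _.
have Bz0' : {in X, forall i, B i z = 0} by move=> i /Bz0; rewrite negbK => /eqP.
rewrite (minor_move_col _ _ (Z1 := [:: z])) ?expr1 /= ?szZ // mulN1r oppr_le0.
rewrite minor_head_row /= ?szZ // => [|j]; last first.
  by rewrite in_cons => /predU1P[->//|/Bx0'].
by rewrite minor_head_col //= !mulr_ge0.
Qed.
End Nonneg.

(** * Sums over the arrangements of a finite set *)

Definition psum (R : nmodType) (I : eqType) (L : seq I) (F : seq I -> R) : R :=
  \sum_(s <- permutations L) F s.

Section Psum.
Variables (R : nmodType) (I : eqType).
Implicit Types (L s t : seq I) (F G : seq I -> R).

Lemma psum_perm L L' F : perm_eq L L' -> psum L F = psum L' F.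
Proof. by move=> eqL; apply: perm_big; apply: perm_permutations. Qed.

Lemma eq_psum L F G : (forall s, perm_eq s L -> F s = G s) -> psum L F = psum L G.
Proof. by move=> eqFG; apply: eq_big_seq => s; rewrite mem_permutations => /eqFG. Qed.

Lemma psum_sum (J : Type) (r : seq J) (P : pred J) L (F : J -> seq I -> R) :
  psum L (fun s => \sum_(j <- r | P j) F j s) = \sum_(j <- r | P j) psum L (F j).
Proof. exact: exchange_big. Qed.

Lemma psum_reindex L F (f : seq I -> seq I) :
  (forall s, perm_eq s L -> perm_eq (f s) L) ->
  (forall s t, perm_eq s L -> perm_eq t L -> f s = f t -> s = t) ->
  psum L (F \o f) = psum L F.
Proof.
move=> fL injf; rewrite /psum -(big_map f predT F); apply: perm_big.
have uf : uniq (map f (permutations L)).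
  rewrite map_inj_in_uniq ?permutations_uniq // => s t.
  by rewrite !mem_permutations; apply: injf.
have [||_ eqf] := @uniq_min_size _ (map f (permutations L)) (permutations L) uf.
- by move=> _ /mapP[s + ->]; rewrite !mem_permutations; apply: fL.
- by rewrite size_map.
by apply: uniq_perm => //; apply: permutations_uniq.
Qed.

Lemma psum_rev L F : psum L (fun s => F (rev s)) = psum L F.
Proof.
apply: (psum_reindex _ (f := rev)) => [s|s t _ _]; first by rewrite perm_rev.
exact: (can_inj revK).
Qed.

Lemma psum_last L F : uniq L -> L != [::] ->
  psum L F = \sum_(y <- L) psum (rem y L) (fun s => F (rcons s y)).
Proof.
move=> uL nL; rewrite -psum_rev /psum (perm_big _ (permutationsE _)) ?lt0n ?size_eq0 //.
rewrite /= big_allpairs_dep undup_id //; apply: eq_bigr => y _.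
rewrite -[RHS]psum_rev; apply: eq_psum => s _.
by rewrite rev_cons.
Qed.

Lemma psum_insert x L F : uniq (x :: L) ->
  psum (x :: L) F =
  \sum_(i < (size L).+1) psum L (fun s => F (take i s ++ x :: drop i s)).
Proof.
move=> /= /andP[xL uL]; rewrite -(big_mkord predT (fun i => psum L (fun s =>
  F (take i s ++ x :: drop i s)))) /psum exchange_big /=.
rewrite -(big_allpairs_dep (h := fun s i => take i s ++ x :: drop i s)).
apply/perm_big/uniq_perm; first exact: permutations_uniq.
  apply: allpairs_uniq_dep => [|s _|]; rewrite ?permutations_uniq ?iota_uniq //.
  move=> _ _ /allpairsPdep[s [i [sL + ->]]] /allpairsPdep[t [j [tL + ->]]] /=.
  rewrite !mem_index_iota /= !ltnS => lei lej eqst.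
  move: sL tL; rewrite !mem_permutations => sL tL.
  have xs u k : perm_eq u L -> (k <= size L)%N ->
      index x (take k u ++ x :: drop k u) = k.
    move=> uL' lek; rewrite index_cat ifN /= ?eqxx ?addn0 ?size_takel //.
      by rewrite (perm_size uL').
    by apply: contra xL => /mem_take; rewrite (perm_mem uL').
  have eqij : i = j by rewrite -(xs s i) // eqst xs.
  rewrite -eqij in eqst *; suff -> : s = t by [].
  have /eqP := eqst; rewrite eqseq_cat ?eqseq_cons ?eqxx /=.
    by case/andP=> /eqP eqt /eqP eqd; rewrite -(cat_take_drop i s) eqt eqd cat_take_drop.
  by rewrite !size_takel // (perm_size sL, perm_size tL).
move=> s; rewrite mem_permutations; apply/idP/allpairsPdep=> [sxL|[t [i [tL _ ->]]]].
  have xs : x \in s by rewrite (perm_mem sxL) mem_head.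
  case/splitPr: xs sxL => s1 s2 sxL.
  have {sxL}sL : perm_eq (s1 ++ s2) L.
    by rewrite -(perm_cons x) -(permPr sxL) -[x :: _]cat1s perm_catCA.
  exists (s1 ++ s2), (size s1); rewrite mem_permutations sL mem_index_iota /= ltnS.
  rewrite -(perm_size sL) size_cat leq_addr; split=> //.
  by rewrite take_size_cat // drop_size_cat.
move: tL; rewrite mem_permutations => tL.
by rewrite -cat1s perm_catCA cat_take_drop perm_cons.
Qed.
End Psum.

(** Fixing the tail of the arrangements leaves a full sum over the arrangements
    of the remaining entries, so a sum over arrangements of products
    head * tail inherits nonnegativity from the sums of the head factor. *)
Lemma psum_split_ge0 (R : numDomainType) (I : eqType) (L : seq I) i
    (f h : seq I -> R) : uniq L -> (i <= size L)%N ->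
  (forall L1, uniq L1 -> {subset L1 <= L} -> size L1 = i -> 0 <= psum L1 f) ->
  (forall t, {subset t <= L} -> 0 <= h t) ->
  0 <= psum L (fun s => f (take i s) * h (drop i s)).
Proof.
move=> + + f_ge0; move: h; have [n leLn] := ubnP (size L).
elim: n L leLn f_ge0 => // n IH L; rewrite ltnS => leLn f_ge0 h uL leiL h_ge0.
have [eqiL|neqiL] := eqVneq i (size L).
  rewrite (eq_psum (G := fun s => f s * h [::])) => [|s sL]; last first.
    by rewrite eqiL -(perm_size sL) take_size drop_size.
  by rewrite /psum -mulr_suml mulr_ge0 ?f_ge0 // h_ge0.
have ltiL : (i < size L)%N by rewrite ltn_neqAle neqiL.
rewrite psum_last -?size_eq0 -?lt0n ?(leq_ltn_trans _ ltiL) //.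
rewrite big_seq; apply: sumr_ge0 => y yL.
have szr : size (rem y L) = (size L).-1 by rewrite size_rem.
have subr : {subset rem y L <= L} by move=> z; apply: mem_rem.
rewrite (eq_psum (G := fun s => f (take i s) * (h \o rcons^~ y) (drop i s))).
  apply: IH; rewrite ?rem_uniq ?szr //; first by rewrite prednK // (leq_trans _ ltiL).
  - by move=> L1 uL1 subL1; apply: f_ge0 => // z /subL1/subr.
  - by rewrite -ltnS prednK // (leq_ltn_trans _ ltiL).
  - move=> t subt; apply: h_ge0 => z; rewrite mem_rcons in_cons.
    by case/predU1P=> [->//|/subt/subr].
move=> s sL; have szs : (i <= size s)%N.
  by rewrite (perm_size sL) szr -ltnS prednK // (leq_ltn_trans _ ltiL).
rewrite /= -cats1 takel_cat // drop_cat.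
by case: ltngtP szs => // [_|->] _; rewrite ?drop_size ?subnn ?cats1.
Qed.

(** * Closed walks with one step replaced by a minor *)

Fixpoint path_weight (R : comNzRingType) (I : Type) (B : I -> I -> R) (x : I)
    (p : seq I) : R :=
  if p is y :: p' then B x y * path_weight B y p' else 1.

Lemma path_weight_cat (R : comNzRingType) (I : Type) (B : I -> I -> R) x p q :
  path_weight B x (p ++ q) = path_weight B x p * path_weight B (last x p) q.
Proof. by elim: p x => [|y p IH] x /=; rewrite ?mul1r // IH mulrA. Qed.

Lemma path_weight_rcons (R : comNzRingType) (I : Type) (B : I -> I -> R) x p y :
  path_weight B x (rcons p y) = path_weight B x p * B (last x p) y.
Proof. by rewrite -cats1 path_weight_cat /= mulr1. Qed.

Lemma rem_nth (I : eqType) (x0 : I) T i : uniq T -> (i < size T)%N ->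
  rem (nth x0 T i) T = take i T ++ drop i.+1 T.
Proof. by move=> uT lti; rewrite remE index_uniq. Qed.

Section Walks.
Variables (R : comNzRingType) (I : eqType) (x0 : I) (B : I -> I -> R) (rho : I).
Local Notation minor := (minor x0).
Local Notation pw := (path_weight B).

(** The closed walk [rho -> q -> q' -> rho], where [drop k s = q ++ q'] and [q]
    has length [r], with the step from [q] to [q'] replaced by the minor through
    which the walk may pick up entries of [T = take k s]. *)
Definition walk_term k r (s : seq I) : R :=
  let T := take k s in
  let q := take r (drop k s) in
  let q' := drop r (drop k s) in
  pw rho q * minor B (last rho q :: T) (head rho q' :: T)
  * pw (head rho q') (behead (rcons q' rho)).

Lemma walk_term_cat k r T q q' : size T = k -> size q = r ->
  walk_term k r (T ++ q ++ q') =
  pw rho q * minor B (last rho q :: T) (head rho q' :: T)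
  * pw (head rho q') (behead (rcons q' rho)).
Proof.
by move=> <- <-; rewrite /walk_term drop_size_cat // !take_size_cat // drop_size_cat.
Qed.

(** The part of a walk term that belongs to one entry [t] of [T = T1 ++ t :: T2] in a
    Laplace expansion along the row of the last vertex of [q]; [y] follows [q]. *)
Let piece T1 t T2 q y p : R :=
  pw rho q * (B (last rho q) t * minor B (t :: T1 ++ T2) (y :: T1 ++ T2))
  * pw y (rcons p rho).

Let on_pieces (V : Type) (f : seq I -> I -> seq I -> seq I -> I -> seq I -> V)
    k r i s : V :=
  f (take i s) (nth x0 s i) (take (k - i.+1) (drop i.+1 s))
    (take r (drop k s)) (nth x0 s (k + r)) (drop (k + r).+1 s).

Let on_pieces_cat V f k r i T1 t T2 q y p :
  size T1 = i -> (i + size T2).+1 = k -> size q = r ->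
  on_pieces (V := V) f k r i (T1 ++ t :: T2 ++ q ++ y :: p) = f T1 t T2 q y p.
Proof.
move=> szT1 szT2 szq; rewrite /on_pieces.
have s1 : drop i.+1 (T1 ++ t :: T2 ++ q ++ y :: p) = T2 ++ q ++ y :: p.
  by rewrite -cat_rcons drop_size_cat // size_rcons szT1.
have s2 : drop k (T1 ++ t :: T2 ++ q ++ y :: p) = q ++ y :: p.
  by rewrite -cat_rcons catA drop_size_cat // size_cat size_rcons szT1 addSn.
have s3 : drop (k + r) (T1 ++ t :: T2 ++ q ++ y :: p) = y :: p.
  by rewrite addnC -drop_drop s2 drop_size_cat.
rewrite s1 s2 take_size_cat // nth_cat szT1 ltnn subnn /= take_size_cat; last first.
  by rewrite -szT2 subSS addKn.
rewrite take_size_cat // -[(k + r).+1]add1n -drop_drop s3 /= drop0.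
by rewrite -[(k + r)%N]addn0 -nth_drop s3.
Qed.

Let piecesP k r i (s : seq I) : (i < k)%N -> (k + r < size s)%N ->
  exists T1 t T2 q y p, [/\ s = T1 ++ t :: T2 ++ q ++ y :: p,
    size T1 = i, (i + size T2).+1 = k & size q = r].
Proof.
move=> lti ltk; exists (take i s), (nth x0 s i), (take (k - i.+1) (drop i.+1 s)).
exists (take r (drop k s)), (nth x0 s (k + r)), (drop (k + r).+1 s).
have lt1 : (i < size s)%N by lia.
split; rewrite ?size_takel ?size_drop //; try lia.
rewrite -drop_nth // [(k + r)%N]addnC -drop_drop cat_take_drop.
have -> : drop k s = drop (k - i.+1) (drop i.+1 s) by rewrite drop_drop subnK.
by rewrite cat_take_drop -drop_nth // cat_take_drop.
Qed.

(** Expanding the minor along its first column before the shift and along its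
    first row after it, the terms match once the next entry of the walk and the
    entry of [T] singled out by the expansion exchange their places. *)
Lemma psum_walk_shift k r L : uniq L -> (k + r < size L)%N ->
  psum L (walk_term k r) = psum L (walk_term k r.+1).
Proof.
move=> uL ltk.
pose e1 k r i := on_pieces piece k r i.
pose e2 k r i := on_pieces (fun T1 t T2 q y p => piece T1 y T2 q t p) k r i.
pose sw k r i := on_pieces (fun T1 t T2 q y p => T1 ++ y :: T2 ++ q ++ t :: p) k r i.
pose a0 s := let q := take r (drop k s) in let y := nth x0 s (k + r) in
  pw rho q * B (last rho q) y * minor B (take k s) (take k s)
  * pw y (rcons (drop (k + r).+1 s) rho).
have main s : perm_eq s L ->
    walk_term k r s = a0 s - \sum_(i < k) e1 k r i s /\
    walk_term k r.+1 s = a0 s - \sum_(i < k) e2 k r i s.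
  move=> sL; have szs : (k + r < size s)%N by rewrite (perm_size sL).
  have us : uniq s by rewrite (perm_uniq sL).
  set T := take k s; set q := take r (drop k s); set y := nth x0 s (k + r).
  set p := drop (k + r).+1 s.
  have szT : size T = k by rewrite size_takel //; lia.
  have uT : uniq T by apply: take_uniq.
  have defs : s = T ++ q ++ y :: p.
    by rewrite -drop_nth // [(k + r)%N]addnC -drop_drop !cat_take_drop.
  have szq : size q = r by rewrite size_takel // size_drop; lia.
  have pwp z : pw z (rcons p rho) =
      B z (head rho p) * pw (head rho p) (behead (rcons p rho)) by case: (p).
  have pieceE f i : (i < k)%N ->
      on_pieces f k r i s = f (take i T) (nth x0 T i) (drop i.+1 T) q y p :> R.
    by move=> lti; rewrite /on_pieces nth_take // take_takel ?(ltnW lti) // take_drop subnK.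
  split.
    have -> : walk_term k r s = walk_term k r (T ++ q ++ y :: p) by rewrite -defs.
    rewrite walk_term_cat //= minor_expand_row // mulrBr mulrBl; congr (_ - _).
      by rewrite /a0 -/T -/q -/y -/p; ring.
    rewrite mulr_sumr mulr_suml (big_nth x0) big_mkord szT; apply: eq_bigr => i _.
    by rewrite /e1 pieceE // /piece rem_nth ?szT.
  have -> : walk_term k r.+1 s = walk_term k r.+1 (T ++ rcons q y ++ p).
    by rewrite cat_rcons -defs.
  rewrite walk_term_cat ?size_rcons ?szq // last_rcons minor_expand_col //.
  rewrite mulrBr mulrBl; congr (_ - _).
    by rewrite /a0 -/T -/q -/y -/p path_weight_rcons pwp; ring.
  rewrite mulr_sumr mulr_suml (big_nth x0) big_mkord szT; apply: eq_bigr => i _.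
  by rewrite /e2 pieceE // /piece rem_nth ?szT // path_weight_rcons pwp; ring.
rewrite (eq_psum (fun s sL => (main s sL).1)) (eq_psum (fun s sL => (main s sL).2)).
rewrite /psum !sumrB; congr (_ - _); rewrite exchange_big [RHS]exchange_big /=.
apply: eq_bigr => i _.
have -> : \sum_(s <- permutations L) e1 k r i s = psum L (e1 k r i) by [].
rewrite -(psum_reindex _ (f := sw k r i)).
- apply: eq_psum => s sL.
  have [|T1 [t [T2 [q [y [p [-> sz1 sz2 szq]]]]]]] := @piecesP k r i s (ltn_ord i).
    by rewrite (perm_size sL).
  by rewrite /e1 /e2 /sw /= !on_pieces_cat.
- move=> s sL; apply: perm_trans (sL).
  have [|T1 [t [T2 [q [y [p [-> sz1 sz2 szq]]]]]]] := @piecesP k r i s (ltn_ord i).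
    by rewrite (perm_size sL).
  by rewrite /sw on_pieces_cat //; apply/seq.permP=> a; rewrite !count_cat /= !count_cat /=; lia.
- move=> s s' sL s'L.
  have [|T1 [t [T2 [q [y [p [-> sz1 sz2 szq]]]]]]] := @piecesP k r i s (ltn_ord i).
    by rewrite (perm_size sL).
  have [|T1' [t' [T2' [q' [y' [p' [-> sz1' sz2' szq']]]]]]] := @piecesP k r i s' (ltn_ord i).
    by rewrite (perm_size s'L).
  rewrite /sw !on_pieces_cat //.
  move/eqP; rewrite eqseq_cat ?sz1 // eqseq_cons eqseq_cat; last by lia.
  rewrite eqseq_cat ?szq // eqseq_cons.
  by case/and5P=> /eqP-> /eqP-> /eqP-> /eqP-> /andP[/eqP-> /eqP->].
Qed.
End Walks.

(** * Path weights of a rank one perturbation *)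

Lemma path_weight_ext (R : comNzRingType) (I : eqType) (B C : I -> I -> R) x p :
  {in x :: p & p, B =2 C} -> path_weight B x p = path_weight C x p.
Proof.
elim: p x => [|y p IH] x //= eqBC; rewrite eqBC ?mem_head // IH // => a b ap bp.
by apply: eqBC; rewrite in_cons ?ap ?bp orbT.
Qed.

Lemma path_weight_map (R : comNzRingType) (I J : Type) (B : J -> J -> R)
    (f : I -> J) x p :
  path_weight (fun x y => B (f x) (f y)) x p = path_weight B (f x) (map f p).
Proof. by elim: p x => [|y p IH] x //=; rewrite IH. Qed.

Lemma path_weight_ge0 (R : numDomainType) (I : eqType) (B : I -> I -> R) x p :
  {in x :: p & p, forall a b, 0 <= B a b} -> 0 <= path_weight B x p.
Proof.
elim: p x => [|y p IH] x //= B0; rewrite mulr_ge0 ?B0 ?mem_head // IH // => a b ap bp.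
by apply: B0; rewrite in_cons ?ap ?bp orbT.
Qed.

Section RankOne.
Variables (R : comNzRingType) (I : eqType) (B C : I -> I -> R) (b : I) (d : R).
Local Notation pw := path_weight.

(** The j-th summand collects the walks whose first step through the rank one part
    of [B] comes after [j] steps through [C]. *)
Lemma path_weight_first z p :
  {in z :: p & p, forall x y, B x y = C x y + d * (B x b * B b y)} ->
  pw B z p = pw C z p + d * \sum_(j < size p)
    pw C z (take j p) * B (last z (take j p)) b * pw B b (drop j p).
Proof.
elim: p z => [|y p IH] z eqB; first by rewrite big_ord0 mulr0 addr0.
rewrite [size _]/= -/(size p) big_ord_recl /=.
transitivity (C z y * pw B y p + d * (B z b * (B b y * pw B y p))).
  by rewrite eqB ?mem_head //; ring.
rewrite {1}IH => [|u v up vp]; last by apply: eqB; rewrite in_cons ?up ?vp orbT.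
rewrite mul1r !mulrDr -!addrA; congr (_ + _).
rewrite [LHS]addrC !mulr_sumr; congr (_ + _).
by apply: eq_bigr => j _; rewrite add0n; ring.
Qed.

(** The j-th summand collects the walks whose last step through the rank one part
    of [B] is the one that enters the j-th vertex of [p]. *)
Lemma path_weight_last z p :
  {in z :: p & p, forall x y, B x y = C x y + d * (B x b * B b y)} ->
  pw B z p = pw C z p + d * \sum_(j < size p)
    pw B z (rcons (take j p) b) * (B b (nth b p j) * pw C (nth b p j) (drop j.+1 p)).
Proof.
elim: p z => [|y p IH] z eqB; first by rewrite big_ord0 mulr0 addr0.
rewrite /= IH => [|u v up vp]; last first.
  by apply: eqB; rewrite in_cons ?up ?vp orbT.
rewrite [size _]/= -/(size p) big_ord_recl /= drop0 mulr1 mulrDr {1}eqB ?mem_head //.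
rewrite mulrDl mulrDr -!addrA; congr (_ + _).
rewrite !mulr_sumr; congr (_ + _); first by ring.
by apply: eq_bigr => j _; rewrite add0n; ring.
Qed.
End RankOne.

(** * Total nonnegativity, pivots and bordered Schur complements *)

Lemma minor_colop (R : comNzRingType) (I : eqType) (x0 : I) (B C : I -> I -> R)
    (c : I -> R) q X Z : size X = (size Z).+1 ->
  {in X, forall x, C x q = B x q} ->
  {in X & Z, forall x z, C x z = B x z - c z * B x q} ->
  minor x0 C X (q :: Z) = minor x0 B X (q :: Z).
Proof.
move=> szX Cq CZ; rewrite (minor_tr _ C) ?(minor_tr _ B) /= ?szX //.
by apply: (@minor_rowop _ _ _ _ _ c) => // z x zZ xX; rewrite CZ.
Qed.

Section TP.
Variable R : realFieldType.
Implicit Types (B C : nat -> nat -> R) (X Z : seq nat).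
Local Notation minor := (minor 0%N).

Definition tp_from lo r B := forall X Z, path ltn lo X -> path ltn lo Z ->
  size Z = size X -> (size X <= r)%N -> 0 <= minor B X Z.

(** Total nonnegativity up to order [r] of the indices above [lo], bordered by the
    root row and by the root column 0, but not by both at once. *)
Definition rooted_tp lo r B := forall X Z, path ltn lo X -> path ltn lo Z ->
  nonneg_minors r B X Z.

Definition subst0 (b i : nat) : nat := if i is 0%N then b else i.

Definition schur B b x z : R := B x z - B x b * B b z / B b b.

(** [C] with [v] as root row and [u] as root column. *)
Definition bordered C (v u : nat -> R) x z : R :=
  if z == 0%N then u x else if x == 0%N then v z else C x z.

Lemma path_gt0 lo X x : path ltn lo X -> x \in X -> (lo < x)%N.
Proof. by move/(order_path_min ltn_trans)/allP; apply. Qed.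

Lemma path_notin0 lo X : path ltn lo X -> 0%N \notin X.
Proof. by move=> hX; apply/negP => /(path_gt0 hX). Qed.

Lemma path_neq0 lo X x : path ltn lo X -> x \in X -> (x == 0%N) = false.
Proof. by move=> hX /(path_gt0 hX); case: x. Qed.

Lemma path_uniq lo X : path ltn lo X -> uniq X.
Proof. by move/path_sorted/(sorted_uniq ltn_trans ltnn). Qed.

Lemma path_cons_gt lo b X : (lo < b)%N -> path ltn b X -> path ltn lo (b :: X).
Proof. by move=> /= ->. Qed.

Lemma path_weaken lo b X : (lo < b)%N -> path ltn b X -> path ltn lo X.
Proof. by case: X => //= x X lob /andP[bx ->]; rewrite (ltn_trans lob bx). Qed.

Lemma path_subseq lo X X' : path ltn lo X -> subseq X' X -> path ltn lo X'.
Proof. by move=> hX sX; apply: subseq_path hX => //; apply: ltn_trans. Qed.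

Lemma map_subst0 b X : 0%N \notin X -> map (subst0 b) X = X.
Proof.
move=> X0; rewrite -[RHS]map_id; apply/eq_in_map => x xX.
by case: x xX X0 => // ->.
Qed.

Lemma rooted_tp_tr lo r B : rooted_tp lo r B -> rooted_tp lo r (fun i j => B j i).
Proof.
move=> hB X Z hX hZ; have [h1 h2 h3] := hB Z X hZ hX; split=> sz szr.
- by rewrite minor_tr // h1 ?sz.
- by rewrite minor_tr /= ?sz // h3.
- by rewrite minor_tr /= ?sz // h2.
Qed.

Lemma rooted_tp_from lo r B : rooted_tp lo r B -> tp_from lo r B.
Proof. by move=> hB X Z hX hZ; have [] := hB X Z hX hZ. Qed.

Lemma minor_subst_col lo B b X Z : path ltn lo Z -> size X = (size Z).+1 ->
  minor (fun i j => B i (subst0 b j)) X (0%N :: Z) = minor B X (b :: Z).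
Proof.
move=> hZ szX; rewrite -(minor_map _ 0%N id) ?map_id /= ?szX //.
by rewrite map_subst0 // (path_notin0 hZ).
Qed.

Lemma minor_subst_row lo B b X Z : path ltn lo X -> size Z = (size X).+1 ->
  minor (fun i j => B (subst0 b i) j) (0%N :: X) Z = minor B (b :: X) Z.
Proof.
move=> hX szZ; rewrite -(minor_map _ 0%N _ id) ?map_id /= ?szZ //.
by rewrite map_subst0 // (path_notin0 hX).
Qed.

(** Total nonnegativity of order two forces the row or the column of a zero
    pivot to vanish, so the elimination formula needs no invertibility. *)
Lemma minor_pivot lo r B b X Z : tp_from lo r B -> (2 <= r)%N -> (lo < b)%N ->
  {in X, forall x, (b < x)%N} -> {in Z, forall z, (b < z)%N} -> size Z = size X ->
  minor B (b :: X) (b :: Z) = B b b * minor (schur B b) X Z.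
Proof.
move=> hB r2 lob hX hZ szZ.
have [Bbb0|nz] := eqVneq (B b b) 0; last first.
  by apply: minor_schur => //; apply/negP=> /hX; rewrite ltnn.
have cross i j : (b < i)%N -> (b < j)%N -> B i b * B b j = 0.
  move=> bi bj; have lo1 l : (b < l)%N -> path ltn lo [:: l].
    by move=> bl; rewrite /= (ltn_trans lob bl).
  apply/eqP; rewrite eq_le -oppr_ge0 mulr_ge0 ?andbT.
  - have := hB [:: b; i] [:: b; j]; rewrite minor2 Bbb0 mul0r sub0r mulrC /= lob bi bj.
    by apply.
  - by have := hB [:: i] [:: b]; rewrite minor1 /= lob (ltn_trans lob bi); apply; lia.
  - by have := hB [:: b] [:: j]; rewrite minor1 /= lob (ltn_trans lob bj); apply; lia.
rewrite Bbb0 mul0r.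
have [/hasP[i iX Bi]|/hasPn Bi0] := boolP (has (fun i => B i b != 0) X).
  apply: (minor_row0 _ (x := b)); rewrite ?mem_head //= ?szZ // => j.
  rewrite in_cons => /predU1P[->//|/hZ bj]; apply: (mulfI Bi).
  by rewrite mulr0 (cross _ _ (hX _ iX) bj).
apply: (minor_col0 _ (z := b)); rewrite ?mem_head //= ?szZ // => i.
by rewrite in_cons => /predU1P[->//|/Bi0]; rewrite negbK => /eqP.
Qed.

Lemma schur_tp lo r B b : tp_from lo r.+1 B -> (lo < b)%N -> 0 < B b b ->
  tp_from b r (schur B b).
Proof.
move=> hB lob Bbb X Z hX hZ szZ szr; rewrite -(pmulr_rge0 _ Bbb).
rewrite -(@minor_schur _ _ _ B) ?gt_eqF //; last first.
  by apply/negP=> /(path_gt0 hX); rewrite ltnn.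
by apply: hB; rewrite ?path_cons_gt //= szZ.
Qed.

(** The Schur complement bordered on top by the original root row: clearing the
    pivot column turns this into Fischer's inequality. *)
Lemma schur_row_ge0 lo r B C b X Z : rooted_tp lo r B -> (lo < b)%N -> 0 < B b b ->
  path ltn b X -> path ltn b Z -> size Z = (size X).+1 -> (size Z <= r)%N ->
  {in Z, forall z, C 0%N z = B 0%N z} ->
  {in X & Z, C =2 schur B b} ->
  0 <= minor C (0%N :: X) Z.
Proof.
move=> hB lob Bbb hX hZ szZ szr C0 CX.
pose D i j := if (i == 0%N) && (j == 0%N) then 0 else B i (subst0 b j).
have hbX : path ltn lo (b :: X) by apply: path_cons_gt.
have hZ' := path_weaken lob hZ.
have le0 : minor D [:: 0, b & X]%N (0%N :: Z) <= 0.
  apply: fischer => //; rewrite ?(path_uniq hbX) ?(path_notin0 hbX) ?(path_notin0 hZ) //.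
  move=> X' Z' sX' sZ'; have hX1 := path_subseq hbX sX'.
  have hZ1 := path_subseq hZ sZ'; have hZ2 := path_subseq hZ' sZ'.
  have [h1 h2 _] := hB X' Z' hX1 hZ2; split=> sz; rewrite /= -szZ => le.
  - rewrite (@minor_ext _ _ _ _ B) ?h1 ?(leq_trans le) // => x z /(path_neq0 hX1) xX.
    by move=> /(path_neq0 hZ1); rewrite /D xX; case: z.
  - rewrite (@minor_ext _ _ _ _ B) ?h2 ?(leq_trans le) // => x z _.
    by move=> /(path_neq0 hZ1); rewrite /D andbC; case: z.
  - rewrite (@minor_ext _ _ _ _ (fun i j => B i (subst0 b j))) /= ?sz // => [|x z]; last first.
      by move=> /(path_neq0 hX1) xX _; rewrite /D xX.
    rewrite (minor_subst_col _ _ hZ1) //.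
    have [+ _ _] := hB X' (b :: Z') hX1 (path_cons_gt lob hZ1).
    by apply; rewrite /= ?sz // -sz (leq_trans le).
move: le0; rewrite (minor_move_row _ _ [:: 0%N]) expr1 mulN1r oppr_le0 /=.
have b0 : (b == 0%N) = false by case: (b) lob.
have Db0 : D b 0%N = B b b by rewrite /D b0.
have bX : b \notin 0%N :: X.
  by rewrite in_cons b0 /=; apply/negP=> /(path_gt0 hX); rewrite ltnn.
rewrite (@minor_schur _ _ _ _ C) ?Db0 ?gt_eqF //.
  by rewrite pmulr_rge0.
move=> x z; have Dz y : z \in Z -> D y z = B y z.
  by move=> /(path_neq0 hZ) z0; rewrite /D z0 andbF; case: (z) z0.
rewrite in_cons => /predU1P[-> zZ|xX zZ].
  by rewrite C0 // Dz // /D /= mul0r mul0r subr0.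
by rewrite CX // /schur !Dz // /D (path_neq0 hX).
Qed.

(** The Schur complement may be bordered by the root row or column of [B], thanks
    to Fischer's inequality, or by the pivot row or column of [B], because row and
    column operations then undo the elimination. *)
Lemma bordered_schur_tp lo r B b v u : tp_from lo r.+1 B -> (lo < b)%N -> 0 < B b b ->
  rooted_tp lo r.+1 B /\ v = B 0%N \/ v = B b ->
  rooted_tp lo r.+1 B /\ u = B^~ 0%N \/ u = B^~ b ->
  rooted_tp b r (bordered (schur B b) v u).
Proof.
move=> hB' lob Bbb hv hu X Z hX hZ; set C := bordered _ _ _.
have b0 : (b == 0%N) = false by case: (b) lob.
have CE : {in X & Z, C =2 schur B b}.
  by move=> x z xX zZ; rewrite /C /bordered (path_neq0 hX xX) (path_neq0 hZ zZ).
have C0 : {in Z, forall z, C 0%N z = v z}.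
  by move=> z zZ; rewrite /C /bordered (path_neq0 hZ).
have Cz : {in X, forall x, C x 0%N = u x} by [].
split=> sz szr.
- by rewrite (@minor_ext _ _ _ _ (schur B b)) // (schur_tp hB').
- case: hv => [[hB hv]|hv]; rewrite hv in C0.
    by apply: (@schur_row_ge0 lo r.+1 B C b) => //; apply: leqW.
  pose B1 i j := B (subst0 b i) j.
  rewrite (@minor_rowop _ _ _ B1 _ (fun x => B x b / B b b)) //.
    rewrite (minor_subst_row _ _ hX) // hB' ?path_cons_gt ?(path_weaken lob hZ) //=.
    by rewrite -sz leqW.
  move=> x z xX zZ; rewrite CE // /schur /B1 /= mulrAC.
  by case: x xX => // /(path_neq0 hX).
- case: hu => [[hB hu]|hu]; rewrite hu in Cz.
    rewrite minor_tr /= ?sz //.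
    apply: (@schur_row_ge0 lo r.+1 (fun i j => B j i) _ b) => //; rewrite ?leqW //.
      exact: rooted_tp_tr.
    by move=> z x zZ xX; rewrite CE // /schur [B x b * _]mulrC.
  pose B1 i j := B i (subst0 b j).
  rewrite (@minor_colop _ _ _ B1 _ (fun z => B b z / B b b)) //.
    rewrite (minor_subst_col _ _ hZ) // hB' ?path_cons_gt ?(path_weaken lob hX) //= ?sz //.
    by rewrite -sz leqW.
  move=> x z xX zZ; rewrite CE // /schur /B1 /= mulrAC [RHS]/=.
  by case: z zZ => [/(path_neq0 hZ)//|z _]; congr (_ - _); ring.
Qed.

End TP.

(** * Positivity of rooted walk sums *)

Lemma sorted_min (L : seq nat) (lo : nat) : uniq L -> all (ltn lo) L -> L != [::] ->
  exists b L', [/\ perm_eq L (b :: L'), (lo < b)%N & path ltn b L'].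
Proof.
move=> uL aL nL; have := sort_sorted leq_total L.
have := permEl (perm_sort leq L); case: (sort leq L) => [|b L'] eqL.
  by move: eqL nL; rewrite perm_sym => /perm_nilP ->.
move=> sL; exists b, L'; split; first by rewrite perm_sym.
  by apply: (allP aL); rewrite -(perm_mem eqL) mem_head.
have : sorted ltn (b :: L') by rewrite ltn_sorted_uniq_leq sL (perm_uniq eqL) uL.
by [].
Qed.

Lemma psum_const (R : nmodType) (I : eqType) (L : seq I) (c : R) :
  psum L (fun=> c) = c *+ size (permutations L).
Proof. by rewrite /psum big_const_seq count_predT iter_addr_0. Qed.

Section RootedPositivity.
Variable R : realFieldType.
Implicit Types (B C : nat -> nat -> R) (L s : seq nat).
Local Notation minor := (minor 0%N).
Local Notation pw := path_weight.
Local Notation walk B := (walk_term 0%N B 0%N).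

(** With a single free entry the sum is a determinant with a zero corner. *)
Lemma psum_walk_base lo k L B : uniq L -> all (ltn lo) L -> size L = k.+1 ->
  rooted_tp lo k.+1 B -> 0 <= psum L (walk B k 1).
Proof.
move=> uL aL szL hB.
have sL : path ltn lo (sort leq L).
  rewrite path_min_sorted ?all_sort //.
  by rewrite ltn_sorted_uniq_leq sort_uniq uL sort_sorted //; apply: leq_total.
rewrite -(psum_perm _ (permEl (perm_sort leq L))).
have szS : size (sort leq L) = k.+1 by rewrite size_sort.
move: (sort leq L) sL szS => {uL aL szL}L hL szL.
have uL := path_uniq hL; have L0 := path_notin0 hL.
pose B0 i j := if (i == 0%N) && (j == 0%N) then 0 else B i j.
have hdet : minor B0 (0%N :: L) (0%N :: L) <= 0.
  apply: fischer => // X Z sX sZ.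
  have hX := path_subseq hL sX; have hZ := path_subseq hL sZ.
  have [h1 h2 h3] := hB X Z hX hZ; rewrite szL; split=> sz szr.
  - rewrite (@minor_ext _ _ _ _ B) ?h1 // => x z /(path_neq0 hX) xX _.
    by rewrite /B0 xX.
  - rewrite (@minor_ext _ _ _ _ B) ?h2 // => x z _ /(path_neq0 hZ) zZ.
    by rewrite /B0 zZ andbF.
  - rewrite (@minor_ext _ _ _ _ B) ?h3 //= ?sz // => x z /(path_neq0 hX) xX _.
    by rewrite /B0 xX.
have nL : L != [::] by rewrite -size_eq0 szL.
rewrite psum_last //.
have -> : \sum_(y <- L) psum (rem y L) (fun s => walk B k 1 (rcons s y)) =
  \sum_(y <- L) (B0 0%N y * minor B0 (y :: rem y L) (0%N :: rem y L)) *+ k`!.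
  apply: eq_big_seq => y yL.
  have szr : size (rem y L) = k by rewrite size_rem // szL.
  rewrite -szr -size_permutations ?rem_uniq // -psum_const; apply: eq_psum => s sr.
  have szs := perm_size sr.
  rewrite -cats1 -[[:: y]]cats0 (@walk_term_cat _ _ _ _ _ _ _ _ [:: y] [::]) //=.
  have y0 : (y == 0%N) = false by apply: contraNF L0 => /eqP <-.
  rewrite !mulr1 /B0 y0 (@minor_perm _ _ _ _ [:: y] [:: 0%N] _ (rem y L)) //=.
  congr (_ * _); apply: minor_ext => // x z; rewrite in_cons => /predU1P[->|].
    by rewrite y0.
  by move/mem_rem; case: (x =P 0%N) => // ->; rewrite (negPf L0).
rewrite sumrMnl mulrn_wge0 //.
by move: hdet; rewrite minor_expand_row // {1}/B0 eqxx mul0r sub0r oppr_le0.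
Qed.

Lemma psum_mulr (I : eqType) (M : seq I) c (F : seq I -> R) :
  psum M (fun u => c * F u) = c * psum M F.
Proof. by rewrite /psum mulr_sumr. Qed.

Lemma rooted_tp_entry lo r B x y : rooted_tp lo r.+1 B ->
  (lo < x)%N -> (lo < y)%N -> 0 <= B x y.
Proof.
move=> hB lox loy; rewrite -(minor1 0%N).
have px : path ltn lo [:: x] by rewrite /= lox.
have py : path ltn lo [:: y] by rewrite /= loy.
by have [+ _ _] := hB _ _ px py; apply.
Qed.

Lemma rooted_tp_row0 lo r B y : rooted_tp lo r.+1 B -> (lo < y)%N -> 0 <= B 0%N y.
Proof.
move=> hB loy; rewrite -(minor1 0%N).
have py : path ltn lo [:: y] by rewrite /= loy.
by have [_ + _] := hB [::] _ isT py; apply.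
Qed.

Lemma rooted_tp_col0 lo r B x : rooted_tp lo r.+1 B -> (lo < x)%N -> 0 <= B x 0%N.
Proof.
move=> hB lox; rewrite -(minor1 0%N).
have px : path ltn lo [:: x] by rewrite /= lox.
by have [_ _ +] := hB _ [::] px isT; apply.
Qed.

Lemma walk_to_root_ge0 lo r B x t : rooted_tp lo r.+1 B -> (lo < x)%N ->
  all (ltn lo) t -> 0 <= pw B x (rcons t 0%N).
Proof.
move=> hB lox lot; rewrite path_weight_rcons.
have gt y : y \in x :: t -> (lo < y)%N.
  by rewrite in_cons => /predU1P[->//|/(allP lot)].
rewrite mulr_ge0 ?(rooted_tp_col0 hB) ?gt ?mem_last // path_weight_ge0 // => a c at_ ct.
by apply: (rooted_tp_entry hB); rewrite gt // in_cons ct orbT.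
Qed.

Lemma rooted_tp_subst_row lo r B b : rooted_tp lo r B -> (lo < b)%N ->
  rooted_tp b r (fun i j => B (subst0 b i) j).
Proof.
move=> hB lob X Z hX hZ.
have hX' := path_weaken lob hX; have hZ' := path_weaken lob hZ.
have [h1 _ h3] := hB X Z hX' hZ'; have h1' := rooted_tp_from hB.
have Bx : {in X, forall x, subst0 b x = x} by case=> // /(path_neq0 hX).
split=> sz szr.
- by rewrite (@minor_ext _ _ _ _ B) ?h1 // => x z /Bx->.
- by rewrite (minor_subst_row _ _ hX) // h1' ?path_cons_gt //= -sz.
- by rewrite (@minor_ext _ _ _ _ B) ?h3 //= ?sz // => x z /Bx->.
Qed.

Lemma rooted_tp_subst_col lo r B b : rooted_tp lo r B -> (lo < b)%N ->
  rooted_tp b r (fun i j => B i (subst0 b j)).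
Proof.
move=> hB lob X Z hX hZ.
have hX' := path_weaken lob hX; have hZ' := path_weaken lob hZ.
have [h1 h2 _] := hB X Z hX' hZ'; have h1' := rooted_tp_from hB.
have Bz : {in Z, forall z, subst0 b z = z} by case=> // /(path_neq0 hZ).
split=> sz szr.
- by rewrite (@minor_ext _ _ _ _ B) ?h1 // => x z _ /Bz->.
- by rewrite (@minor_ext _ _ _ _ B) ?h2 //= ?sz // => x z _ /Bz->.
- by rewrite (minor_subst_col _ _ hZ) // h1' ?path_cons_gt //= -sz.
Qed.

Lemma subst0_gt lo b x : (lo < x)%N -> subst0 b x = x. Proof. by case: x. Qed.

(** A walk that visits [b] right after the root may forget the root: what follows
    is a walk from the root again once the root row is replaced by row [b]. *)
Lemma walk_insert_first B b k s : all (ltn 0) s -> (k < size s)%N ->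
  walk B k 1 (take k s ++ b :: drop k s) =
  B 0%N b * walk (fun i j => B (subst0 b i) j) k 0 s.
Proof.
move=> s0 lek; set T := take k s; have szT : size T = k by rewrite size_takel // ltnW.
have [y [p defp]] : exists y p, drop k s = y :: p.
  by case: (drop k s) (size_drop k s) => [|y p]; [move=> /= /eqP; lia | exists y, p].
have defs : s = T ++ y :: p by rewrite -defp cat_take_drop.
rewrite [in RHS]defs -[y :: p in RHS]cat0s -/T defp -[b :: y :: p]cat1s.
rewrite !walk_term_cat //= mulr1 mul1r -mulrA.
rewrite {}defs all_cat /= in s0; case/and3P: s0 => T0 y0 p0.
have Tn0 : 0%N \notin T by apply/negP=> /(allP T0).
congr (_ * (_ * _)).
  by rewrite -[RHS](minor_map _ 0%N (subst0 b) id) ?map_id //= map_subst0.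
rewrite !path_weight_rcons; congr (_ * _).
  apply: path_weight_ext => u v up _; rewrite (@subst0_gt 0) //.
  by move: up; rewrite in_cons => /predU1P[->//|/(allP p0)].
rewrite (@subst0_gt 0) //; have := mem_last y p.
by rewrite in_cons => /predU1P[->//|/(allP p0)].
Qed.

(** A walk that visits [b] after the minor splits at [b] into a walk whose root
    column is column [b] and a path from [b] back to the root. *)
Lemma walk_insert_later B b k i s : all (ltn 0) s -> (k < i)%N -> (i <= size s)%N ->
  walk B k 1 (take i s ++ b :: drop i s) =
  walk (fun i j => B i (subst0 b j)) k 1 (take i s) * pw B b (rcons (drop i s) 0%N).
Proof.
move=> s0 lti lei; set t := drop i s.
have defu : take i s = take k s ++ drop k (take i s).
  by rewrite -{1}(cat_take_drop k (take i s)) take_takel // ltnW.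
move: defu (size_drop k (take i s)); rewrite size_takel //.
set T := take k s; have szT : size T = k by rewrite size_takel //; lia.
case: (drop k _) => [|y q] defu /= szq; first by lia.
have u0 : all (ltn 0) (take i s) by apply/allP=> x /mem_take/(allP s0).
rewrite defu all_cat /= in u0; case/and3P: u0 => T0 y0 q0.
have Tn0 : 0%N \notin T by apply/negP=> /(allP T0).
rewrite defu -catA !cat_cons -[y :: q ++ _]cat1s -[y :: q]cat1s !walk_term_cat //=.
rewrite !mulr1 (@subst0_gt 0) // -!mulrA; congr (_ * _).
case: q => [|z q] /= in szq defu q0 *.
  rewrite mul1r; congr (_ * _).
  by rewrite -[RHS](minor_map _ 0%N id (subst0 b)) ?map_id //= map_subst0.
case/andP: q0 => z0 q0; rewrite rcons_cat rcons_cons -cat_rcons.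
rewrite path_weight_cat last_rcons !mulrA; congr (_ * _ * _).
  apply: minor_ext => // x w _; rewrite in_cons => wT; rewrite (@subst0_gt 0) //.
  by case/predU1P: wT => [->//|/(allP T0)].
rewrite !path_weight_rcons; congr (_ * _).
by apply: path_weight_ext => u v _ vq; rewrite (@subst0_gt 0) //; apply: (allP q0).
Qed.

(** [b] enters the minor: pivoting on it leaves a minor of the Schur complement,
    and the remaining steps of the walk are split at the first one that uses
    the rank one part of [B]. *)
Lemma walk_insert_minor lo r B b k i s : tp_from lo r B -> (2 <= r)%N -> (lo < b)%N ->
  all (ltn b) s -> (i <= k)%N -> (k.+1 < size s)%N ->
  let W u := bordered (schur B b) (B 0%N) u in
  walk B k.+1 1 (take i s ++ b :: drop i s) =
  B b b * walk (W (B^~ 0%N)) k 1 s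
  + (B b b != 0)%:R * \sum_(j < size s - k.+2)
     walk (W (B^~ b)) k 1 (take (k.+2 + j) s) *
     pw B b (rcons (drop (k.+2 + j) s) 0%N).
Proof.
move=> hB r2 lob sb lei szk W; set T := take k s.
have szT : size T = k by rewrite size_takel //; lia.
have [y [z [p defp]]] : exists y z p, drop k s = [:: y, z & p].
  move: (size_drop k s); case: (drop k s) => [|y [|z p]] //= szd; try lia.
  by exists y, z, p.
have defs : s = T ++ [:: y, z & p] by rewrite -defp cat_take_drop.
have szs : (size s = k + (size p).+2)%N by rewrite defs size_cat szT.
have sb' x : x \in s -> (b < x)%N by move/(allP sb).
have Tb x : x \in T -> (b < x)%N by move/mem_take/sb'.
have yb : (b < y)%N by apply: sb'; rewrite defs mem_cat mem_head orbT.
have zpb x : x \in z :: p -> (b < x)%N.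
  by move=> xp; apply: sb'; rewrite defs mem_cat in_cons xp !orbT.
have n0 x : (b < x)%N -> (x == 0%N) = false by case: x.
set T' := take i T ++ b :: drop i T.
have defi : take i s ++ b :: drop i s = T' ++ [:: y] ++ z :: p.
  rewrite /T' -catA /= take_takel //; congr (_ ++ _ :: _).
  rewrite {1}defs drop_cat szT; case: ltnP => // leki.
  have -> : i = k by apply/eqP; rewrite eqn_leq lei.
  by rewrite subnn drop0 drop_oversize // szT.
have szT' : size T' = k.+1 by rewrite size_cat /= addnS -size_cat cat_take_drop szT.
rewrite defi walk_term_cat //= mulr1.
have -> : minor B (y :: T') (z :: T') = B b b * minor (schur B b) (y :: T) (z :: T).
  rewrite (@minor_perm _ _ _ _ [:: y] [:: z] _ (b :: T)) //; last first.
    by rewrite /T' -cat1s perm_catCA cat_take_drop.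
  rewrite (@minor_move _ _ _ _ [:: y] _ _ [:: z]) //.
  apply: (minor_pivot hB) => //= x; rewrite in_cons => /predU1P[->|/Tb] //.
  by apply: zpb; rewrite mem_head.
have WE u x w : (b < x)%N -> (b < w)%N -> W u x w = schur B b x w.
  by move=> /n0 x0 /n0 w0; rewrite /W /bordered x0 w0.
have mW u : minor (W u) (y :: T) (z :: T) = minor (schur B b) (y :: T) (z :: T).
  apply: minor_ext => // x w; rewrite !in_cons => xT wT; apply: WE.
    by case/predU1P: xT => [->|/Tb].
  by case/predU1P: wT => [->|/Tb//]; rewrite zpb ?mem_head.
have pwW u q : {subset q <= p} ->
    pw (W u) z (rcons q 0%N) = pw (schur B b) z q * u (last z q).
  move=> qp; rewrite path_weight_rcons; congr (_ * _).
  apply: path_weight_ext => x w xq wq; apply: WE; apply: zpb.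
    by move: xq; rewrite !in_cons => /orP[->//|/qp->]; rewrite orbT.
  by rewrite in_cons qp ?orbT.
have walkW u q t : {subset q <= p} -> size t = k -> t = T ->
    walk (W u) k 1 (t ++ [:: y, z & q]) =
    B 0%N y * minor (schur B b) (y :: T) (z :: T) *
    (pw (schur B b) z q * u (last z q)).
  move=> qp szt ->; rewrite -[[:: y, z & q]]cat1s walk_term_cat //=.
  rewrite mulr1 mW pwW // /W /bordered /= n0 //.
have [Bbb0|nz] := eqVneq (B b b) 0.
  by rewrite Bbb0 !mul0r mulr0 mul0r addr0.
rewrite mul1r [in walk _ _ _ s]defs walkW //.
have -> : \sum_(j < size s - k.+2) walk (W (B^~ b)) k 1 (take (k.+2 + j) s) *
     pw B b (rcons (drop (k.+2 + j) s) 0%N) =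
  \sum_(j < size p) B 0%N y * minor (schur B b) (y :: T) (z :: T) *
    (pw (schur B b) z (take j p) * B (last z (take j p)) b) *
    (pw B b (drop j p) * B (last z p) 0%N).
  have szp : (size s - k.+2 = size p)%N by lia.
  rewrite szp; apply: eq_bigr => j _.
  have ltj := ltn_ord j.
  have dropE : drop (k.+2 + j) s = drop j p.
    by rewrite addnC -drop_drop -[k.+2]/(2 + k)%N -drop_drop defp /= drop0.
  have takeE : take (k.+2 + j) s = T ++ [:: y, z & take j p].
    rewrite {1}defs -[k.+2]/(2 + k)%N addnAC addnC takeD take_size_cat //.
    by rewrite drop_size_cat.
  rewrite dropE takeE walkW //; last by move=> x /mem_take.
  rewrite path_weight_rcons; congr (_ * (_ * B _ _)).
  have -> : last z p = last z (take j p ++ drop j p) by rewrite cat_take_drop.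
  rewrite last_cat.
  have : drop j p != [::] by rewrite -size_eq0 size_drop subn_eq0 -ltnNge.
  by case: (drop j p).
rewrite path_weight_rcons (path_weight_first (b := b) (C := schur B b) (d := (B b b)^-1)).
  rewrite mulrDl mulrDr; congr (_ + _); first by ring.
  rewrite [X in _ * X]mulrAC mulrA mulr_sumr; apply: eq_bigr => j _.
  by field.
by move=> x w _ _; rewrite /schur; field.
Qed.

(** The smallest index [b] of [L] is inserted at every place [i] of an arrangement
    of the others: into the minor, first on the walk, or later on the walk. *)
Theorem psum_walk_ge0 k L lo B : uniq L -> all (ltn lo) L -> (k < size L)%N ->
  rooted_tp lo k.+1 B -> 0 <= psum L (walk B k 1).
Proof.
have [n] := ubnP (size L); elim: n k L lo B => // n IH k L lo B.
rewrite ltnS => leLn uL aL ltkL hB.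
have [szL|neL] := eqVneq (size L) k.+1; first exact: psum_walk_base szL hB.
have nL : L != [::] by case: (L) ltkL.
have [b [L' [eqL lob hL']]] := sorted_min uL aL nL.
have hL'lo := path_weaken lob hL'.
rewrite (psum_perm _ eqL) psum_insert -?(perm_uniq eqL) //.
have szL : size L = (size L').+1 := perm_size eqL.
have ltL'n : (size L' < n)%N by rewrite -szL.
have uL' := path_uniq hL'.
have gtL' (s : seq nat) : perm_eq s L' -> all (ltn b) s.
  by move=> sL'; apply/allP=> x; rewrite (perm_mem sL'); apply: path_gt0.
apply: sumr_ge0 => i _; have lei := ltn_ord i; rewrite ltnS in lei.
have sub_gt (L1 : seq nat) : {subset L1 <= L'} -> all (ltn b) L1.
  by move=> sub; apply/allP=> x /sub; apply: path_gt0.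
have all0 (s : seq nat) : perm_eq s L' -> all (ltn 0) s.
  by move/gtL'; apply: sub_all => x /=; apply: leq_ltn_trans.
have ge_h t : {subset t <= L'} -> 0 <= pw B b (rcons t 0%N).
  move=> tL'; apply: (walk_to_root_ge0 hB) => //; apply/allP=> x /tL'.
  exact: path_gt0.
case: (ltngtP i k) => [ltik|ltki|eqik].
- case: k ltik ltkL hB neL => // k ltik ltkL hB neL; rewrite ltnS in ltik.
  have hB' := rooted_tp_from hB; have ltk : (k.+1 < size L')%N by lia.
  have ltk' := ltnW ltk.
  rewrite (eq_psum (fun s sL' => walk_insert_minor hB' isT lob (gtL' s sL') ltik
    (eq_rect_r (fun m => k.+1 < m)%N ltk (perm_size sL')))).
  have -> : psum L' (fun s => B b b * walk (bordered (schur B b) (B 0%N) (B^~ 0%N)) k 1 s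
      + (B b b != 0)%:R * \sum_(j < size s - k.+2)
        walk (bordered (schur B b) (B 0%N) (B^~ b)) k 1 (take (k.+2 + j) s)
        * pw B b (rcons (drop (k.+2 + j) s) 0%N)) =
    B b b * psum L' (walk (bordered (schur B b) (B 0%N) (B^~ 0%N)) k 1)
    + (B b b != 0)%:R * \sum_(j < size L' - k.+2) psum L' (fun s =>
        walk (bordered (schur B b) (B 0%N) (B^~ b)) k 1 (take (k.+2 + j) s)
        * pw B b (rcons (drop (k.+2 + j) s) 0%N)).
    rewrite -!psum_mulr -psum_sum -psum_mulr /psum -big_split /=.
    by apply: eq_psum => s sL'; rewrite (perm_size sL').
  have [Bbb0|nz] := eqVneq (B b b) 0; first by rewrite Bbb0 !mul0r addr0.
  have Bbb : 0 < B b b by rewrite lt_def nz (rooted_tp_entry hB).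
  have hW u := @bordered_schur_tp _ lo _ B b (B 0%N) u hB' lob Bbb (or_introl (conj hB erefl)).
  rewrite mul1r addr_ge0 ?mulr_ge0 ?(ltW Bbb) //.
    apply: (IH _ _ b) => //; rewrite ?sub_gt //.
    by apply: hW; left.
  apply: sumr_ge0 => j _; have ltj := ltn_ord j.
  (* The walk up to the first rank one step is a rooted walk sum of its own. *)
  have lej : (k.+2 + j <= size L')%N by lia.
  have ltkj : (k < k.+2 + j)%N by lia.
  apply: (psum_split_ge0 (h := fun t => pw B b (rcons t 0%N))) => // L1 uL1 /sub_gt aL1 szL1.
  apply: (IH _ _ b) => //; rewrite ?szL1 //; first exact: leq_ltn_trans lej _.
    by apply: hW; right.
- rewrite (eq_psum (fun s sL' => walk_insert_later B b (all0 s sL') ltki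
    (eq_rect_r (fun m => i <= m)%N lei (perm_size sL')))).
  apply: (psum_split_ge0 (h := fun t => pw B b (rcons t 0%N))) => // [L1 uL1 /sub_gt aL1 szL1].
  apply: (IH _ _ b) => //; rewrite ?szL1 //; first by lia.
  exact: rooted_tp_subst_col hB lob.
- have ltk : (k < size L')%N by lia.
  rewrite eqik (eq_psum (fun s sL' => walk_insert_first B b (all0 s sL')
    (eq_rect_r (fun m => k < m)%N ltk (perm_size sL')))).
  rewrite psum_mulr mulr_ge0 ?(rooted_tp_row0 hB) // psum_walk_shift ?addn0 //.
  apply: (IH _ _ b) => //; rewrite ?sub_gt //.
  exact: rooted_tp_subst_row hB lob.
Qed.

End RootedPositivity.

(** * Positivity of cycle sums *)

Definition cycle_term (R : comNzRingType) (I : eqType) (x0 : I) (B : I -> I -> R)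
    k (s : seq I) : R :=
  if drop k s is y :: p then
    path_weight B y p * minor x0 B (last y p :: take k s) (y :: take k s)
  else 0.

Lemma cycle_term_cat (R : comNzRingType) (I : eqType) (x0 : I) (B : I -> I -> R)
    k T y p : size T = k ->
  cycle_term x0 B k (T ++ y :: p) =
  path_weight B y p * minor x0 B (last y p :: T) (y :: T).
Proof. by move=> szT; rewrite /cycle_term drop_size_cat // take_size_cat. Qed.

Lemma psum_walk_shift_all (R : comNzRingType) (I : eqType) (x0 : I) (B : I -> I -> R)
    rho k r L : uniq L -> (k + r <= size L)%N ->
  psum L (walk_term x0 B rho k r) = psum L (walk_term x0 B rho k 0).
Proof.
move=> uL; elim: r => // r IH ltr; rewrite -psum_walk_shift -?addnS // IH //.
by rewrite ltnW // -addnS.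
Qed.

Lemma walk_term_map (R : comNzRingType) (I J : eqType) (x0 : I) (y0 : J)
    (B : J -> J -> R) (f : I -> J) rho k r s :
  walk_term y0 B (f rho) k r (map f s) =
  walk_term x0 (fun x y => B (f x) (f y)) rho k r s.
Proof.
rewrite /walk_term -map_take -map_drop -map_take -map_drop; set T := take k s.
set q := take r _; set q' := drop r _.
have hd : head (f rho) (map f q') = f (head rho q') by case: (q').
have bh : behead (rcons (map f q') (f rho)) = map f (behead (rcons q' rho)).
  by case: (q') => //= a l; rewrite map_rcons.
by rewrite hd bh last_map -!path_weight_map -(minor_map x0 y0 f f) ?size_map.
Qed.

(** When [b] lies on the cycle, cut the cycle at [b]. *)
Lemma cycle_insert_path (R : comNzRingType) (I : eqType) (x0 : I) (B : I -> I -> R)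
    b k i s : (k <= i)%N -> (i <= size s)%N ->
  cycle_term x0 B k (take i s ++ b :: drop i s) =
  walk_term x0 B b k (size s - i)%N (take k s ++ rot (i - k)%N (drop k s)).
Proof.
move=> leki lei; set T := take k s; set q := take (i - k)%N (drop k s).
set q' := drop i s.
have szT : size T = k by rewrite size_takel // (leq_trans leki).
have -> : take i s = T ++ q by rewrite -takeD subnKC.
have -> : rot (i - k)%N (drop k s) = q' ++ q by rewrite /rot drop_drop subnK.
rewrite walk_term_cat ?size_drop //.
case: q => [|z q]; first by rewrite cats0 cycle_term_cat //= mulr1.
rewrite -catA cat_cons cycle_term_cat // -cat_rcons path_weight_cat last_rcons.
rewrite last_cat last_rcons /=.
by ring.
Qed.

Section CyclePositivity.
Variable R : realFieldType.
Implicit Types (B C : nat -> nat -> R) (L s : seq nat).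
Local Notation minor := (minor 0%N).
Local Notation pw := path_weight.
Local Notation walk B := (walk_term 0%N B 0%N).

(** When [b] lies in the minor, pivoting on it brings in the Schur complement. The
    path either stays in the Schur complement, or leaves it between a first and a
    last rank one step. Then the part after the last of these steps and the part
    before the first one, in this order, form a walk from row [b] to column [b]
    that contains the minor; [turn] brings them together. *)
Lemma cycle_insert_minor lo r B b k i s : tp_from lo r B -> (2 <= r)%N -> (lo < b)%N ->
  all (ltn b) s -> (i <= k)%N -> (k < size s)%N ->
  let W := bordered (schur B b) (B b) (B^~ b) in
  let m := size s in
  let turn j l := take k s ++ rot (j.+1 + l)%N (drop k s) in
  cycle_term 0%N B k.+1 (take i s ++ b :: drop i s) =
  B b b * cycle_term 0%N (schur B b) k s
  + (B b b != 0)%:R / B b b * \sum_(j < m - k.+1) \sum_(l < m - k.+1 - j)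
     walk W k (m - k - (j.+1 + l))%N (take (m - l)%N (turn j l)) *
     pw B b (rcons (drop (m - l)%N (turn j l)) b).
Proof.
move=> hB r2 lob sb lei szk W m turn; rewrite /turn; set T := take k s.
have szT : size T = k by rewrite size_takel //; lia.
have [y [p defp]] : exists y p, drop k s = y :: p.
  move: (size_drop k s); case: (drop k s) => [|y p] //= szd; try lia.
  by exists y, p.
have defs : s = T ++ y :: p by rewrite -defp cat_take_drop.
have szs : (size s = k + (size p).+1)%N by rewrite defs size_cat szT.
have sb' x : x \in s -> (b < x)%N by move/(allP sb).
have Tb x : x \in T -> (b < x)%N by move/mem_take/sb'.
have ypb x : x \in y :: p -> (b < x)%N.
  by move=> xp; apply: sb'; rewrite defs mem_cat xp orbT.
have n0 x : (b < x)%N -> (x == 0%N) = false by case: x.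
set T' := take i T ++ b :: drop i T.
have defi : take i s ++ b :: drop i s = T' ++ y :: p.
  rewrite /T' -catA /= take_takel //; congr (_ ++ _ :: _).
  rewrite {1}defs drop_cat szT; case: ltnP => // leki.
  have -> : i = k by apply/eqP; rewrite eqn_leq lei.
  by rewrite subnn drop0 drop_oversize // szT.
have szT' : size T' = k.+1 by rewrite size_cat /= addnS -size_cat cat_take_drop szT.
rewrite defi cycle_term_cat // [in cycle_term _ _ _ s]defs cycle_term_cat //.
set z := last y p; have zb : (b < z)%N by rewrite ypb // mem_last.
have yb : (b < y)%N by rewrite ypb ?mem_head.
have -> : minor B (z :: T') (y :: T') = B b b * minor (schur B b) (z :: T) (y :: T).
  rewrite (@minor_perm _ _ _ _ [:: z] [:: y] _ (b :: T)) //; last first.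
    by rewrite /T' -cat1s perm_catCA cat_take_drop.
  rewrite (@minor_move _ _ _ _ [:: z] _ _ [:: y]) //.
  by apply: (minor_pivot hB) => //= x; rewrite in_cons => /predU1P[->|/Tb].
have [Bbb0|nz] := eqVneq (B b b) 0.
  by rewrite Bbb0 !mul0r mulr0 addr0.
have WE x w : (b < x)%N -> (b < w)%N -> W x w = schur B b x w.
  by move=> /n0 x0 /n0 w0; rewrite /W /bordered x0 w0.
have [M defM] : exists M, minor (schur B b) (z :: T) (y :: T) = M.
  by exists (minor (schur B b) (z :: T) (y :: T)).
rewrite defM.
have schurE : {in y :: p & p, forall x w, B x w = schur B b x w + (B b b)^-1 * (B x b * B b w)}.
  by move=> x w _ _; rewrite /schur; field.
rewrite (path_weight_first schurE) mulrDl; congr (_ + _); first by ring.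
rewrite div1r mulr_sumr mulr_suml [RHS]mulr_sumr.
have -> : (m - k.+1 = size p)%N by rewrite /m szs; lia.
apply: eq_bigr => j _; set t := drop j p.
have ltj := ltn_ord j; have szt : size t = (size p - j)%N by rewrite size_drop.
have tp : {subset t <= p} by move=> x /mem_drop.
have schurE' : {in b :: t & t, forall x w, B x w = schur B b x w + (B b b)^-1 * (B x b * B b w)}.
  by move=> x w _ _; rewrite /schur; field.
rewrite (path_weight_last schurE') szt.
have -> : pw (schur B b) b t = 0.
  case: (t) szt => [|v t'] /=; first by move/esym/eqP; rewrite subn_eq0 leqNgt ltj.
  by move=> _; rewrite /schur [B b b * _]mulrC mulfK // subrr mul0r.
rewrite add0r !mulr_sumr mulr_suml; apply: eq_bigr => l _.
have ltl : (l < size t)%N by rewrite szt.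
set u := take l t; set g := drop l t.
have defg : g = nth b t l :: drop l.+1 t by rewrite /g -drop_nth.
have szg : (size g = m - k - (j.+1 + l))%N.
  by rewrite size_drop szt /m szs; lia.
have -> : T ++ rot (j.+1 + l)%N (drop k s) = (T ++ g ++ y :: take j p) ++ u.
  rewrite defp -[y :: p](_ : (y :: take j p) ++ u ++ g = _); last first.
    by rewrite /u /g cat_take_drop cat_cons cat_take_drop.
  have <- : size ((y :: take j p) ++ u) = (j.+1 + l)%N.
    by rewrite size_cat /= !size_takel // ltnW.
  by rewrite catA rot_size_cat !catA.
have sz1 : size (T ++ g ++ y :: take j p) = (m - l)%N.
  rewrite !size_cat /= szg szT size_takel ?(ltnW ltj) // /m szs.
  by move: ltl ltj; rewrite szt; clear; move: (size p) (j : nat) (l : nat) => a c e; lia.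
rewrite take_size_cat // drop_size_cat // walk_term_cat //.
have lastg : last 0%N g = z.
  rewrite /z -(cat_take_drop j p) last_cat -/t -(cat_take_drop l t) last_cat -/g.
  by rewrite defg.
have gb x : x \in g -> (b < x)%N by move=> /mem_drop/tp xp; rewrite ypb // in_cons xp orbT.
rewrite lastg /=.
have -> : minor W (z :: T) (y :: T) = M.
  rewrite -defM; apply: minor_ext => // x w; rewrite !in_cons => xT wT; apply: WE.
    by case/predU1P: xT => [->|/Tb].
  by case/predU1P: wT => [->|/Tb].
have -> : pw W 0%N g = B b (nth b t l) * pw (schur B b) (nth b t l) (drop l.+1 t).
  rewrite {1}defg /= {1}/W /bordered n0 ?gb ?defg ?mem_head //; congr (_ * _).
  apply: path_weight_ext => x w xg wg; apply: WE; apply: gb; rewrite defg //.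
  by rewrite in_cons wg orbT.
have -> : pw W y (rcons (take j p) 0%N) =
    pw (schur B b) y (take j p) * B (last y (take j p)) b.
  rewrite path_weight_rcons; congr (_ * _); apply: path_weight_ext => x w xp wp.
  apply: WE; apply: ypb; last by rewrite in_cons (mem_take wp) orbT.
  by move: xp; rewrite !in_cons => /predU1P[->|/mem_take->]; rewrite ?eqxx ?orbT.
by field.
Qed.

Lemma tp_from_entry lo r B x y : tp_from lo r.+1 B ->
  (lo < x)%N -> (lo < y)%N -> 0 <= B x y.
Proof.
by move=> hB lox loy; rewrite -(minor1 0%N) hB //= ?lox ?loy.
Qed.

Lemma rooted_tp_at lo r B b : tp_from lo r B -> (lo < b)%N ->
  rooted_tp b r (fun i j => B (subst0 b i) (subst0 b j)).
Proof.
move=> hB lob X Z hX hZ.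
have hX' := path_weaken lob hX; have hZ' := path_weaken lob hZ.
have X0 := path_notin0 hX; have Z0 := path_notin0 hZ.
split=> sz szr.
- by rewrite -(minor_map _ 0%N) // !map_subst0 // hB.
- by rewrite -(minor_map _ 0%N) //= !map_subst0 // hB ?path_cons_gt //= -sz.
- by rewrite -(minor_map _ 0%N) //= ?sz // !map_subst0 // hB ?path_cons_gt //= -sz.
Qed.

(** The smallest index [b] of [L] lies either on the cycle, which is then cut at
    [b] and becomes a rooted walk, or in the minor. *)
Theorem psum_cycle_ge0 k L lo B : uniq L -> all (ltn lo) L -> (k < size L)%N ->
  tp_from lo k.+1 B -> 0 <= psum L (cycle_term 0%N B k).
Proof.
have [n] := ubnP (size L); elim: n k L lo B => // n IH k L lo B.
rewrite ltnS => leLn uL aL ltkL hB.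
have nL : L != [::] by case: (L) ltkL.
have [b [L' [eqL lob hL']]] := sorted_min uL aL nL.
have [szL|neL] := eqVneq (size L) k.+1.
  rewrite /psum big_seq; apply: sumr_ge0 => s; rewrite mem_permutations => sL.
  have [y defy] : exists y, drop k s = [:: y].
    move: (size_drop k s); rewrite (perm_size sL) szL subSnn.
    by case: (drop k s) => [|y [|]] //; exists y.
  rewrite /cycle_term defy /= mul1r.
  rewrite (@minor_perm _ _ _ _ [::] [::] _ (b :: L')) //=; last first.
    rewrite -(permPr eqL) -(permPr sL) -[X in perm_eq _ X](cat_take_drop k) defy cats1.
    by rewrite perm_sym perm_rcons.
  by rewrite hB ?path_cons_gt // -(perm_size eqL) szL.
rewrite (psum_perm _ eqL) psum_insert -?(perm_uniq eqL) //.
have szL : size L = (size L').+1 := perm_size eqL.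
have ltL'n : (size L' < n)%N by rewrite -szL.
have ltk : (k < size L')%N by lia.
have uL' := path_uniq hL'.
have sub_gt (L1 : seq nat) : {subset L1 <= L'} -> all (ltn b) L1.
  by move=> sub; apply/allP=> x /sub; apply: path_gt0.
have gtL' (s : seq nat) : perm_eq s L' -> all (ltn b) s.
  by move=> sL'; apply: sub_gt => x; rewrite (perm_mem sL').
apply: sumr_ge0 => i _; have lei : (i <= size L')%N by rewrite -ltnS.
have [ltik|leki] := ltnP i k; last first.
  pose turn s := take k s ++ rot (i - k)%N (drop k s).
  pose B' x y := B (subst0 b x) (subst0 b y).
  rewrite (eq_psum (G := walk_term 0%N B b k (size L' - i)%N \o turn)) => [|s sL']; last first.
    by rewrite cycle_insert_path ?(perm_size sL').
  rewrite psum_reindex.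
  - rewrite psum_walk_shift_all //; last by lia.
    rewrite psum_walk_shift ?addn0 //.
    rewrite (eq_psum (G := walk B' k 1)) => [|s sL'].
      apply: (@psum_walk_ge0 _ _ _ b) => //; first exact: sub_gt.
      exact: rooted_tp_at hB lob.
    rewrite -(walk_term_map _ 0%N _ (subst0 b)) map_subst0 //.
    by apply/negP=> /(allP (gtL' _ sL')).
  - move=> s sL'; rewrite /turn; apply: perm_trans (sL').
    by rewrite -{3}(cat_take_drop k s) perm_cat2l perm_rot.
  - move=> s t sL' tL' /eqP; rewrite /turn eqseq_cat ?size_takel ?(perm_size sL') ?(perm_size tL') 1?ltnW //.
    case/andP=> /eqP e1 /eqP /rot_inj e2.
    by rewrite -(cat_take_drop k s) e1 e2 cat_take_drop.
case: k ltik ltkL hB neL ltk => // k ltik ltkL hB neL ltk; rewrite ltnS in ltik.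
have ltk' := ltnW ltk.
pose turn j l s := take k s ++ rot (j.+1 + l)%N (drop k s).
pose W := bordered (schur B b) (B b) (B^~ b).
pose m := size L'.
pose f j l s := walk W k (m - k - (j.+1 + l))%N (take (m - l)%N s) *
  pw B b (rcons (drop (m - l)%N s) b).
have -> : psum L' (fun s => cycle_term 0%N B k.+1 (take i s ++ b :: drop i s)) =
    B b b * psum L' (cycle_term 0%N (schur B b) k)
    + (B b b != 0)%:R / B b b * \sum_(j < m - k.+1) \sum_(l < m - k.+1 - j)
      psum L' (f j l \o turn j l).
  rewrite -psum_mulr; under eq_bigr => j _ do rewrite -psum_sum.
  rewrite -psum_sum -psum_mulr /psum -big_split /=.
  apply: eq_psum => s sL'; rewrite (cycle_insert_minor hB _ lob (gtL' s sL') ltik) //.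
    by rewrite /f /m -(perm_size sL').
  by rewrite (perm_size sL').
have [Bbb0|nz] := eqVneq (B b b) 0; first by rewrite Bbb0 !mul0r addr0.
have Bbb : 0 < B b b by rewrite lt_def nz (tp_from_entry hB).
rewrite div1r addr_ge0 ?mulr_ge0 ?invr_ge0 ?(ltW Bbb) //.
  apply: (IH _ _ b) => //; first exact: sub_gt.
  exact: schur_tp hB lob Bbb.
apply: sumr_ge0 => j _; apply: sumr_ge0 => l _.
have ltj := ltn_ord j; have ltl := ltn_ord l.
rewrite psum_reindex.
- have lem : (m - l <= m)%N by apply: leq_subr.
  have ltkm : (k < m - l)%N by lia.
  apply: (psum_split_ge0 (h := fun t => pw B b (rcons t b))) => // [L1 uL1 /sub_gt aL1 szL1|t tL'].
    rewrite psum_walk_shift_all ?szL1 //; last by lia.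
    rewrite psum_walk_shift ?addn0 ?szL1 //.
    apply: (@psum_walk_ge0 _ _ _ b); rewrite ?szL1 //.
    by apply: (bordered_schur_tp hB lob Bbb); right.
  apply: path_weight_ge0 => x w; rewrite in_cons mem_rcons in_cons => hx hw.
  have gtb v : (v == b) || (v \in t) -> (lo < v)%N.
    by case/predU1P=> [->//|/tL'/(path_gt0 hL')]; apply: ltn_trans.
  apply: (tp_from_entry hB); apply: gtb; last by rewrite mem_rcons in hw.
  by case/or3P: hx => ->; rewrite ?orbT.
- move=> s sL'; rewrite /turn; apply: perm_trans (sL').
  by rewrite -{3}(cat_take_drop k s) perm_cat2l perm_rot.
- move=> s t sL' tL' /eqP; rewrite /turn eqseq_cat ?size_takel ?(perm_size sL') ?(perm_size tL') 1?ltnW //.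
  case/andP=> /eqP e1 /eqP /rot_inj e2.
  by rewrite -(cat_take_drop k s) e1 e2 cat_take_drop.
Qed.

End CyclePositivity.

(** * The class function of a cycle sum *)

Lemma path_weight_nth (R : comNzRingType) (I : Type) (x0 : I) (B : I -> I -> R) y p :
  path_weight B y p = \prod_(i < size p) B (nth x0 (y :: p) i) (nth x0 p i).
Proof.
elim: p y => [|z p IH] y /=; first by rewrite big_ord0.
by rewrite big_ord_recl /= IH.
Qed.

(** Rows with a single entry, each in the column of the next row, peel off. *)
Lemma minor_chain (R : comNzRingType) (I : eqType) (x0 : I) (B : I -> I -> R) u p y T :
  uniq (p ++ T) -> u \notin p ->
  (forall i, (i < size p)%N -> {in u :: p ++ T, forall j, j != nth x0 p i ->
     B (nth x0 (y :: p) i) j = 0}) ->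
  minor x0 B (y :: p ++ T) (u :: p ++ T) =
  (-1) ^+ size p * (path_weight B y p * minor x0 B (last y p :: T) (u :: T)).
Proof.
elim: p y => [|z p IH] y uT up hB; first by rewrite /= !mul1r.
move: (uT) (up); rewrite /= in_cons negb_or => /andP[zT uT'] /andP[uz up'].
have By j : j \in u :: z :: p ++ T -> j != z -> B y j = 0 by move/(hB 0%N isT); apply.
rewrite minor_expand_row // By ?mem_head // mul0r sub0r big_cons /= eqxx big1_seq => [|t /andP[_ tT]].
  rewrite addr0 IH // => [|i lti j jT]; first by rewrite exprS; ring.
  by apply: (hB i.+1) => //; move: jT; rewrite !in_cons => /predU1P[->|->]; rewrite ?eqxx ?orbT.
rewrite By ?mul0r ?in_cons ?tT ?orbT //.
by apply: contraNneq zT => <-.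
Qed.

Section Immanant.
Variables (R : realType) (n' k : nat).
Local Notation n := n'.+1.
Implicit Types (A : 'M[R]_n) (s : seq 'I_n) (sigma : 'S_n).

Definition follows sigma s := sorted (fun x y => sigma x == y) (drop k s).

(** The sum is [k`!] times the number of indices whose orbit under [sigma] has at
    least [n - k] elements: it counts the enumerations of the indices in which the
    last [n - k] are successive images under [sigma]. *)
Definition hook_function sigma : R :=
  (-1) ^+ (n' - k) * (-1) ^+ sigma *
  psum (enum 'I_n) (fun s => (follows sigma s)%:R).

Lemma hook_function_class : class_function hook_function.
Proof.
move=> sigma t; rewrite /hook_function odd_permJ; congr (_ * _).
rewrite -(psum_reindex _ (f := map t)) => [|s sE|s s' _ _]; last 2 first.
- apply: uniq_perm; rewrite ?enum_uniq ?(map_inj_uniq perm_inj) ?(perm_uniq sE) ?enum_uniq //.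
  move=> x; rewrite mem_enum; apply/mapP; exists (t^-1 x)%g; rewrite ?permKV //.
  by rewrite (perm_mem sE) mem_enum.
- by apply/inj_map/perm_inj.
apply: eq_psum => s _ /=; congr (_%:R); rewrite /follows -map_drop.
case: (drop k s) => //= y p; rewrite path_map; congr (nat_of_bool _).
by apply: eq_path => x z /=; rewrite permJ (inj_eq perm_inj).
Qed.

(** The Leibniz formula for [A] with the rows of all path vertices but the last
    reduced to the entry in the column of the next vertex. *)
Lemma cycle_term_leibniz A s : perm_eq s (enum 'I_n) -> (k < n)%N ->
  cycle_term ord0 A k s =
  \sum_(sigma : 'S_n) (-1) ^+ (n' - k) * (-1) ^+ sigma * (follows sigma s)%:R *
    \prod_i A i (sigma i).
Proof.
move=> sE ltk.
have szs : size s = n by rewrite (perm_size sE) size_enum_ord.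
have us : uniq s by rewrite (perm_uniq sE) enum_uniq.
rewrite /cycle_term /follows; set T := take k s.
have defs := cat_take_drop k s; rewrite -/T in defs.
move: (size_drop k s) defs; rewrite szs; case: (drop k s) => [|y p].
  by move=> /= /esym/eqP; rewrite subn_eq0 leqNgt ltk.
rewrite subSn // => -[szp] defs.
have uyp : uniq ((y :: p) ++ T) by rewrite uniq_catC defs.
have uyp' := uyp; rewrite cat_uniq in uyp'; case/and3P: uyp' => uyp' pT uT.
pose B x j : R := if (index x (y :: p) < size p)%N then
  A x j * (j == nth ord0 p (index x (y :: p)))%:R else A x j.
have idx i : (i < size p)%N -> index (nth ord0 (y :: p) i) (y :: p) = i.
  by move=> lti; rewrite index_uniq //= ltnW.
have detE : \det (\matrix_(i, j) B i j) =
    \sum_(sigma : 'S_n) (-1) ^+ sigma *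
      ((path (fun x z => sigma x == z) y p)%:R * \prod_i A i (sigma i)).
  apply: eq_bigr => sigma _; congr (_ * _).
  have [/(pathP ord0) fol|/(pathP ord0) nfol] := boolP (path _ y p).
    rewrite mul1r; apply: eq_bigr => x _; rewrite mxE /B.
    case: ifP => // ltx; have := fol _ ltx; rewrite nth_index; last first.
      by rewrite -index_mem (leq_trans ltx) //= leqnSn.
    by move=> ->; rewrite mulr1.
  rewrite mul0r; apply/eqP/negPn/negP => /prodf_neq0 nz; apply: nfol => i lti.
  have := nz (nth ord0 (y :: p) i) isT; rewrite mxE /B idx // lti mulf_eq0 negb_or.
  by case/andP=> _; rewrite pnatr_eq0 eqb0 negbK.
have minE : \det (\matrix_(i, j) B i j) = minor ord0 B (y :: p ++ T) (y :: p ++ T).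
  rewrite -(@minor_perm _ _ _ _ [::] [::] (enum 'I_n)) //.
    rewrite (@minorE _ _ _ n) ?size_enum_ord //=; congr (\det _).
    by apply/matrixP=> i j; rewrite !mxE !nth_ord_enum.
  by rewrite -(permPl sE) -defs -cat_cons perm_catC.
rewrite minE minor_chain in detE; first last.
- move=> i lti j _ ne; rewrite /B idx // lti (negPf ne) mulr0 //.
- by case/andP: uyp'.
- by case/andP: uyp.
have -> : path_weight A y p = path_weight B y p.
  rewrite !(path_weight_nth ord0); apply: eq_bigr => i _.
  by rewrite /B idx ?ltn_ord // eqxx mulr1.
have -> : minor ord0 A (last y p :: T) (y :: T) = minor ord0 B (last y p :: T) (y :: T).
  apply: minor_ext => // x j + _; rewrite in_cons /B => /predU1P[->|xT].
    by rewrite index_last ?ltnn.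
  by rewrite memNindex ?ltnNge ?leqnSn //; apply: contra pT => xp; apply/hasP; exists x.
apply: (mulfI (x := (-1) ^+ size p)); first by rewrite signr_eq0.
rewrite detE mulr_sumr; apply: eq_bigr => sigma _.
by rewrite -szp !mulrA -exprD addnn -mul2n exprM sqrrN !expr1n mul1r.
Qed.

Lemma immanant_hook_function A : (k < n)%N ->
  immanant hook_function A = psum (enum 'I_n) (cycle_term ord0 A k).
Proof.
move=> ltk; rewrite (eq_psum (fun s sE => cycle_term_leibniz A sE ltk)) psum_sum.
apply: eq_bigr => sigma _; rewrite /hook_function /psum mulr_sumr mulr_suml.
by apply: eq_bigr.
Qed.

End Immanant.

(** * Class functions and Young subgroups *)

Lemma expg_porbit_mod (T : finType) (s : {perm T}) x a :
  (s ^+ a)%g x = (s ^+ (a %% #|porbit s x|))%g x.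
Proof.
rewrite {1}(divn_eq a #|porbit s x|) addnC expgD permM mulnC expgM.
set y := (s ^+ _)%g x; elim: (a %/ _)%N => [|m IH]; first by rewrite perm1.
rewrite expgSr permM {}IH permX -(porbit_perm s (a %% #|porbit s x|) x) -/y.
by rewrite iter_porbit.
Qed.

Lemma expg_porbit_inj (T : finType) (s : {perm T}) x a b :
  (s ^+ a)%g x = (s ^+ b)%g x -> a = b %[mod #|porbit s x|].
Proof.
rewrite (expg_porbit_mod _ _ a) (expg_porbit_mod _ _ b) => eqab; set c := #|_| in eqab *.
have c_gt0 : (0 < c)%N by rewrite lt0n card_porbit_neq0.
have nthE m : (m < c)%N -> nth x (traject s x c) m = (s ^+ m)%g x.
  by move=> ltm; rewrite nth_traject // permX.
apply/eqP; rewrite -(nth_uniq x (s := traject s x c)) ?size_traject ?ltn_pmod //.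
  by rewrite !nthE ?ltn_pmod // eqab.
exact: uniq_traject_porbit.
Qed.

(** Permutations with the same orbits are conjugate: send the j-th iterate of an
    orbit representative under [s] to its j-th iterate under [t]. *)
Lemma same_porbits_conjg (T : finType) (s t : {perm T}) :
  (forall x, porbit t x = porbit s x) -> exists y, t = (s ^ y)%g.
Proof.
move=> eqo.
pose rep x := odflt x [pick y in porbit s x].
have rep_in x : rep x \in porbit s x.
  by rewrite /rep; case: pickP => [y //|/(_ x)]; rewrite porbit_id.
have rep_eq x y : porbit s x = porbit s y -> rep x = rep y.
  rewrite /rep => ->; case: pickP => // /(_ y); rewrite porbit_id //.
have idx x : exists a, x == (s ^+ a)%g (rep x).
  have /porbitP[a ->] : x \in porbit s (rep x) by rewrite porbit_sym rep_in.
  by exists a; rewrite (rep_eq _ x) ?porbit_perm //; apply/eqP; rewrite eq_porbit_mem rep_in.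
pose j x := xchoose (idx x).
have jP x : x = (s ^+ j x)%g (rep x) by apply/eqP/(xchooseP (idx x)).
have eqmod r a b : ((s ^+ a)%g r == (s ^+ b)%g r) = ((t ^+ a)%g r == (t ^+ b)%g r).
  apply/eqP/eqP => /expg_porbit_inj eqab.
    by rewrite expg_porbit_mod eqo eqab -eqo -expg_porbit_mod.
  by rewrite expg_porbit_mod -eqo eqab eqo -expg_porbit_mod.
pose f x := (t ^+ j x)%g (rep x).
have fo x : porbit s (f x) = porbit s x.
  by rewrite -eqo porbit_perm eqo; apply/eqP; rewrite eq_porbit_mem rep_in.
have f_inj : injective f.
  move=> x y eqf; have eqr : rep x = rep y by apply: rep_eq; rewrite -fo eqf fo.
  rewrite (jP x) (jP y) eqr; apply/eqP; rewrite eqmod -{1}eqr; exact/eqP.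
exists (perm f_inj); apply/permP=> x; rewrite -{2}[x](permKV (perm f_inj)) permJ.
set y := ((perm f_inj)^-1)%g x; rewrite -[x in LHS](permKV (perm f_inj)) -/y !permE.
have eqr : rep (s y) = rep y.
  by apply: rep_eq; have := porbit_perm s 1 y; rewrite expg1.
rewrite /f eqr -permM -expgSr; apply/esym/eqP; rewrite -eqmod expgSr permM -jP.
by rewrite -eqr -jP.
Qed.

Section ClassFunctions.
Variables (R : realType) (n : nat).
Implicit Types (f : 'S_n -> R) (lam : seq nat).

Lemma eta_count lam (s : 'S_n) :
  eta R lam s * #|young n lam|%:R = \sum_(y : 'S_n) ((s ^ y)%g \in young n lam)%:R.
Proof.
pose c := (\sum_(y : 'S_n) ((s ^ y)%g \in young n lam))%N.
have eqc : (Num.truncn (eta_cf n lam s) * #|young n lam|)%N = c.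
  apply/eqP; rewrite -(eqr_nat algC) natrM etaE cfIndE ?subsetT // mulrAC mulVf ?mul1r.
    rewrite natr_sum; apply/eqP; apply: eq_big => [y|y _]; first by rewrite inE.
    by rewrite cfun1E.
  exact: neq0CG.
by rewrite /eta -natrM eqc natr_sum.
Qed.

(** Frobenius reciprocity for a character induced from a trivial one. *)
Lemma inner_eta lam f : class_function f ->
  inner (eta R lam) f = #|young n lam|%:R^-1 * \sum_(t in young n lam) f t.
Proof.
move=> cf; rewrite /inner.
have H_neq0 : #|young n lam|%:R != 0 :> R by rewrite pnatr_eq0 -lt0n cardG_gt0.
have -> : \sum_s eta R lam s * f (s^-1)%g = #|young n lam|%:R^-1 *
    \sum_(s : 'S_n) \sum_(y : 'S_n) ((s ^ y)%g \in young n lam)%:R * f ((s ^ y)^-1)%g.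
  rewrite mulr_sumr; apply: eq_bigr => s _.
  under eq_bigr => y _ do rewrite -conjVg cf.
  by rewrite -mulr_suml -eta_count mulrA [_^-1 * _]mulrC mulfK.
rewrite exchange_big /= mulrCA; congr (_ * _).
have -> : \sum_(y : 'S_n) \sum_(s : 'S_n) ((s ^ y)%g \in young n lam)%:R * f ((s ^ y)^-1)%g
  = \sum_(y : 'S_n) \sum_(t in young n lam) f t.
  apply: eq_bigr => y _; rewrite (reindex_inj (@conjg_inj _ (y^-1)%g)) /=.
  rewrite (reindex_inj (@invg_inj _)) /= [RHS]big_mkcond; apply: eq_bigr => t _ /=.
  by rewrite conjgKV groupV invgK; case: ifP; rewrite ?mul1r ?mul0r.
by rewrite sumr_const card_Sn -[X in _ * X]mulr_natl mulKf // pnatr_eq0 -lt0n fact_gt0.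
Qed.
End ClassFunctions.

Lemma perm_flatten_fibers (I T : eqType) (h : I -> T) (s : seq I) (u : seq T) :
  uniq u ->
  perm_eq (flatten [seq [seq x <- s | h x == v] | v <- u]) [seq x <- s | h x \in u].
Proof.
elim: u => [|v u IH] /=; first by move=> _; rewrite filter_pred0.
case/andP=> vu /IH eqf.
rewrite (perm_trans (y := [seq x <- s | h x == v] ++ [seq x <- s | h x \in u])) //.
  by rewrite perm_cat2l.
apply/seq.permP=> a; rewrite count_cat !count_filter -count_predUI.
rewrite [X in (_ + X)%N](@eq_count _ _ pred0) ?count_pred0 ?addn0 => [|x] /=.
  by apply: eq_count => x /=; rewrite in_cons andb_orr.
by case: eqP => [->|_]; rewrite ?andbF ?(negPf vu) ?andbF.
Qed.

(** Every labelling of the indices is, up to a permutation, constant exactly on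
    the blocks of a Young subgroup. *)
Lemma labelling_young n (T : eqType) (h : 'I_n -> T) :
  exists (lam : seq nat) (pi : 'S_n), is_partition n lam /\ forall i j,
    (h (pi i) == h (pi j)) = (reshape_index lam i == reshape_index lam j).
Proof.
case: n h => [|n] h.
  by exists [::], 1%g; split=> // -[].
pose fib v := [seq x <- enum 'I_n.+1 | h x == v].
pose u := sort (relpre (size \o fib) geq) (undup (map h (enum 'I_n.+1))).
have uu : uniq u by rewrite sort_uniq undup_uniq.
have mem_u x : h x \in u by rewrite mem_sort mem_undup map_f ?mem_enum.
pose ss := map fib u; pose lam := shape ss.
have flat : perm_eq (flatten ss) (enum 'I_n.+1).
  apply: perm_trans (perm_flatten_fibers _ _ uu) _.
  by rewrite (eq_filter (a2 := predT)) ?filter_predT // => x; rewrite mem_u.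
have sum_lam : sumn lam = n.+1 by rewrite -size_flatten (perm_size flat) size_enum_ord.
have uflat : uniq (flatten ss) by rewrite (perm_uniq flat) enum_uniq.
pose f (i : 'I_n.+1) := nth ord0 (flatten ss) i.
have szf : size (flatten ss) = n.+1 by rewrite size_flatten.
have f_inj : injective f.
  by move=> i j /eqP; rewrite nth_uniq ?szf ?ltn_ord // => /eqP/val_inj.
have v0 := h ord0.
have hf i : h (f i) = nth v0 u (reshape_index lam i).
  have lti : (i < sumn lam)%N by rewrite sum_lam.
  have ltr := reshape_indexP lti; have lto := reshape_offsetP lti.
  rewrite /lam size_map size_map -/lam in ltr.
  rewrite /f nth_flatten -/lam (nth_map v0) //.
  apply/eqP; rewrite -/(fib _).
  have : nth ord0 (fib (nth v0 u (reshape_index lam i))) (reshape_offset lam i)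
      \in fib (nth v0 u (reshape_index lam i)).
    apply: mem_nth; move: lto; rewrite {2}/lam /shape (nth_map [::]) ?size_map //.
    by rewrite (nth_map v0).
  by rewrite mem_filter => /andP[].
exists lam, (perm f_inj); split=> [|i j].
  rewrite /is_partition sum_lam eqxx /=; apply/andP; split.
    rewrite /lam /shape /ss -map_comp sorted_map; apply: sort_sorted => a b.
    exact: leq_total.
  apply/allP=> _ /mapP[_ /mapP[v vu ->] ->]; rewrite -has_predT.
  move: vu; rewrite mem_sort mem_undup => /mapP[x _ ->].
  by apply/hasP; exists x; rewrite // mem_filter eqxx mem_enum.
have ltr (l : 'I_n.+1) : (reshape_index lam l < size u)%N.
  by have := @reshape_indexP lam l; rewrite sum_lam !size_map; apply.
by rewrite !permE !hf nth_uniq.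
Qed.

Section Uniqueness.
Variables (R : realType) (n : nat).
Implicit Types (f : 'S_n -> R).

(** A labelling subgroup is conjugate to a Young subgroup. *)
Lemma sum_labelling f (T : eqType) (h : 'I_n -> T) : class_function f ->
  (forall lam, is_partition n lam -> \sum_(t in young n lam) f t = 0) ->
  \sum_(t : 'S_n | [forall x, h (t x) == h x]) f t = 0.
Proof.
move=> cf f0; have [lam [pi [hlam hpi]]] := labelling_young h.
rewrite -[RHS](f0 lam hlam) (reindex_inj (@conjg_inj _ pi)) /=.
apply: eq_big => [t|t _]; last by rewrite cf.
rewrite inE; apply/forallP/forallP => ht i.
  by rewrite -hpi -(permJ t).
have := ht (pi^-1 i)%g; rewrite -hpi -(permJ t) permKV.
by [].
Qed.

(** Among the permutations preserving every orbit of [s], those with the same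
    orbits are conjugate to [s] and the others have smaller orbits. *)
Lemma class_function_eq0 f : class_function f ->
  (forall lam, is_partition n lam -> \sum_(t in young n lam) f t = 0) ->
  forall s, f s = 0.
Proof.
move=> cf f0 s; pose M (t : 'S_n) := (\sum_x #|porbit t x|)%N.
have [m] := ubnP (M s); elim: m s => // m IH s; rewrite ltnS => leM.
have := sum_labelling (porbit s) cf f0.
have sub (t : 'S_n) : [forall x, porbit s (t x) == porbit s x] ->
    forall x, porbit t x \subset porbit s x.
  move=> /forallP ht x; apply/subsetP=> _ /porbitP[i ->].
  elim: i => [|i IHi]; first by rewrite perm1 porbit_id.
  by rewrite expgSr permM -eq_porbit_mem (eqP (ht _)) eq_porbit_mem.
pose same (t : 'S_n) := [forall x, porbit t x == porbit s x].
rewrite (bigID same) /= [X in _ + X]big1 ?addr0 => [|t /andP[ht nsame]]; last first.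
  apply: IH; apply: leq_trans leM; rewrite ltn_neqAle.
  have [le_ eq_] := leqif_sum (fun x (_ : true) => subset_leqif_card (sub t ht x)).
  rewrite le_ andbT eq_; apply: contra nsame => /forallP sm; apply/forallP=> x.
  by rewrite eqEsubset sub //=; apply: sm.
have fs (t : 'S_n) : same t -> f t = f s.
  by move=> /forallP st; have [x|y ->] := @same_porbits_conjg _ s t; [apply/eqP|apply: cf].
rewrite (eq_bigr (fun=> f s)) => [|t /andP[_ /fs]//].
rewrite sumr_const => /eqP; rewrite mulrn_eq0 => /orP[|/eqP//].
move/eqP/card0_eq/(_ s); rewrite inE /= => /negbT; rewrite negb_and.
case/orP=> /forallP[] x; last by [].
by have := porbit_perm s 1 x; rewrite expg1 => ->.
Qed.

End Uniqueness.

(** * Cycle sums of block matrices *)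

Lemma sumn_ge_size l : all (leq 1) l -> (size l <= sumn l)%N.
Proof. by elim: l => //= x l IH /andP[x1 /IH]; lia. Qed.

Lemma all1_of_sumn l : all (leq 1) l -> (sumn l <= size l)%N -> l = nseq (size l) 1%N.
Proof.
elim: l => //= x l IH /andP[x1 l1] le; have := sumn_ge_size l1 => ge.
have -> : x = 1%N by lia.
by rewrite -IH //; lia.
Qed.

Lemma hook_of_large_part n a k r lam : is_partition n lam -> n = (a + k)%N ->
  size lam = k.+1 -> (a <= nth 0%N lam r)%N -> lam = hook a k.
Proof.
case: lam => [|x l]; first by case/and3P.
case/and3P=> /eqP sl srt /= /andP[x1 l1] eqn [szl] le.
have lex : (nth 0%N (x :: l) r <= x)%N.
  case: r {le} => [|r] //=; have [ltr|?] := ltnP r (size l); last by rewrite nth_default.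
  have := order_path_min (rev_trans leq_trans) srt => /allP; apply.
  exact: mem_nth.
have ge := sumn_ge_size l1; rewrite /= in sl; rewrite szl in ge.
have xa : x = a by lia.
by rewrite /hook xa -szl -all1_of_sumn //; lia.
Qed.

Section Blocks.
Variables (R : realType) (n' k : nat) (lam : seq nat).
Local Notation n := n'.+1.
Hypothesis ltk : (k < n)%N.
Implicit Types s : seq 'I_n.

Let b (i : 'I_n) := reshape_index lam i.
Let J : 'M[R]_n := \matrix_(i, j) (b i == b j)%:R.

Lemma immanant_blocks (f : 'S_n -> R) :
  immanant f J = \sum_(t in young n lam) f t.
Proof.
rewrite /immanant [RHS]big_mkcond; apply: eq_bigr => s _; rewrite inE.
case: ifPn => [/forallP hs|]; last rewrite negb_forall => /existsP[i hi].
  by rewrite big1 ?mulr1 // => i _; rewrite mxE eq_sym (hs i).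
by rewrite (bigD1 i) //= mxE eq_sym (negPf hi) mul0r mulr0.
Qed.

Lemma minor_blocks y T :
  minor ord0 J (y :: T) (y :: T) = (uniq (map b (y :: T)))%:R.
Proof.
have [ub|nub] := boolP (uniq _).
  rewrite /minor -[RHS](det1 _ (size (y :: T))); congr (\det _).
  apply/matrixP=> i j; rewrite !mxE -!(nth_map _ 0%N) ?ltn_ord //.
  by rewrite nth_uniq ?size_map ?ltn_ord.
have [i [j [lti ltj neij eqij]]] : exists i j, [/\ (i < size (y :: T))%N,
    (j < size (y :: T))%N, i != j & b (nth ord0 (y :: T) i) = b (nth ord0 (y :: T) j)].
  have /(uniqPn 0%N)[i [j [ltij ltj eqij]]] := nub.
  rewrite size_map in ltj; exists i, j; split=> //; first exact: ltn_trans ltj.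
    by rewrite neq_ltn ltij.
  by rewrite -!(nth_map _ 0%N) // (ltn_trans ltij).
rewrite mulr0n /minor.
apply: (determinant_alternate (i1 := Ordinal lti) (i2 := Ordinal ltj)) => // l.
by rewrite !mxE /= eqij.
Qed.

Lemma path_weight_blocks y p :
  path_weight J y p = (all (fun x => b x == b y) p)%:R.
Proof.
elim: p y => //= x p IH y; rewrite IH mxE eq_sym.
by have [->|_] := eqVneq (b x) (b y); rewrite ?mul1r ?mul0r.
Qed.

(** The path must stay in one block, and the minor has two equal rows unless its
    indices lie in different blocks, in which case it is the identity. *)
Lemma cycle_term_blocks s : cycle_term ord0 J k s =
  (if drop k s is y :: p then
     all (fun x => b x == b y) p && uniq (map b (y :: take k s)) else false)%:R.
Proof.
rewrite /cycle_term; case: (drop k s) => // y p; rewrite path_weight_blocks.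
have [/allP eqb|_] := boolP (all _ _); last by rewrite mul0r.
rewrite mul1r -minor_blocks; congr (\det _); apply/matrixP=> -[[|i] lti] j; rewrite !mxE //=.
congr (_ == _)%:R; have := mem_last y p.
by rewrite in_cons => /predU1P[->//|/eqb/eqP].
Qed.

(** A block structure with a nonzero term has one block of size [n - k], filled
    by the cycle, and singletons otherwise. *)
Lemma cycle_term_blocks_hook s : is_partition n lam -> perm_eq s (enum 'I_n) ->
  cycle_term ord0 J k s != 0 -> lam = hook (n - k) k.
Proof.
move=> hlam sE; rewrite cycle_term_blocks.
have szs : size s = n by rewrite (perm_size sE) size_enum_ord.
have us : uniq s by rewrite (perm_uniq sE) enum_uniq.
have ins x : x \in s by rewrite (perm_mem sE) mem_enum.
set T := take k s; have szT : size T = k by rewrite size_takel // szs ltnW.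
have := cat_take_drop k s; rewrite -/T; have := size_drop k s; rewrite szs.
case: (drop k s) => [|y p] szp defs; first by rewrite eqxx.
rewrite pnatr_eq0 eqb0 negbK => /andP[/allP pb ub].
have sum_lam : sumn lam = n by case/and3P: hlam => /eqP.
have bE i : (b i < size lam)%N by apply: reshape_indexP; rewrite sum_lam.
have szlam : size lam = k.+1.
  have -> : k.+1 = size (map b (y :: T)) by rewrite size_map /= szT.
  apply/eqP; rewrite eqn_leq -[X in (X <= _)%N](size_iota 0).
  rewrite uniq_leq_size ?iota_uniq //; last first.
    move=> r; rewrite mem_iota add0n /= => ltr.
    have part_gt0 : (0 < nth 0%N lam r)%N.
      by case/and3P: hlam => _ _ /allP; apply; apply: mem_nth.
    have ltf : (flatten_index lam r 0 < n)%N.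
      rewrite -sum_lam -[X in (_ < sumn X)%N](cat_take_drop r) sumn_cat (drop_nth 0%N) //=.
      by rewrite /flatten_index ltn_add2l (leq_trans part_gt0) ?leq_addr.
    have br : b (Ordinal ltf) = r by apply: flatten_indexKl.
    have := ins (Ordinal ltf); rewrite -defs mem_cat in_cons => xs.
    have {xs}xs : (Ordinal ltf \in T) || (b (Ordinal ltf) == b y).
      by case/or3P: xs => [->//|/eqP->|/pb->]; rewrite ?eqxx orbT.
    rewrite -br; case/orP: xs => [xT|/eqP->]; last exact: mem_head.
    by rewrite in_cons; apply/orP; right; apply: map_f.
  rewrite andTb -[X in (_ <= X)%N](size_iota 0); apply: uniq_leq_size => // r.
  by rewrite mem_iota add0n => /mapP[i _ ->] /=.
apply: (hook_of_large_part (n := n) (r := b y)) => //; first by rewrite subnK // ltnW.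
pose off (i : 'I_n) := reshape_offset lam i.
have bq x : x \in y :: p -> b x = b y.
  by rewrite in_cons => /predU1P[->//|/pb/eqP].
rewrite -szp -(size_map off) -[X in (_ <= X)%N](size_iota 0); apply: uniq_leq_size.
  rewrite map_inj_in_uniq; first by move: us; rewrite -defs cat_uniq => /and3P[].
  move=> i j /bq bi /bq bj eqo; apply: val_inj => /=.
  by rewrite -(reshape_indexK lam i) -(reshape_indexK lam j) -/(b i) -/(b j) bi bj -/(off i) eqo.
move=> _ /mapP[i /bq bi ->]; rewrite mem_iota add0n /= -bi.
by apply: reshape_offsetP; rewrite sum_lam.
Qed.

Lemma reshape_hook_head a m : (m < a)%N -> reshape_index (hook a k) m = 0%N.
Proof.
move=> ltm; have -> : m = flatten_index (hook a k) 0 m by rewrite /flatten_index add0n.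
exact: flatten_indexKl.
Qed.

Lemma reshape_hook_tail a j : (j < k)%N -> reshape_index (hook a k) (a + j) = j.+1.
Proof.
move=> ltj; have -> : (a + j)%N = flatten_index (hook a k) j.+1 0.
  by rewrite /flatten_index addn0 /= take_nseq ?(ltnW ltj) // sumn_nseq mul1n.
by apply: flatten_indexKl; rewrite /= nth_nseq ltj.
Qed.

(** The arrangement listing the singletons before the large block contributes 1. *)
Lemma hook_blocks_gt0 : lam = hook (n - k) k ->
  0 < psum (enum 'I_n) (cycle_term ord0 J k).
Proof.
set a := (n - k)%N => lamE; pose E := enum 'I_n.
have a_gt0 : (0 < a)%N by rewrite subn_gt0.
have valE : map val E = iota 0 n by rewrite val_enum_ord.
have szE : size E = n by rewrite size_enum_ord.
have term1 : cycle_term ord0 J k (drop a E ++ take a E) = 1.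
  rewrite cycle_term_blocks.
  have szd : size (drop a E) = k by rewrite size_drop szE /a subKn // ltnW.
  rewrite drop_size_cat // take_size_cat //.
  have vt : map val (take a E) = iota 0 a.
    by rewrite map_take valE take_iota (minn_idPl (leq_subr _ _)).
  have vd : map val (drop a E) = iota a k.
    by rewrite map_drop valE drop_iota /a subKn // ltnW.
  have bt x : x \in take a E -> b x = 0%N.
    move=> /(map_f val); rewrite vt mem_iota add0n => /= ltx.
    by rewrite /b lamE reshape_hook_head.
  case: (take a E) vt bt => [/= /(congr1 size)|y p _ bt].
    by rewrite size_iota => /= a0; rewrite -a0 in a_gt0.
  have -> : all (fun x => b x == b y) p.
    by apply/allP=> x xp; rewrite !bt ?mem_head // in_cons xp orbT.
  have -> : map b (y :: drop a E) = iota 0 k.+1.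
    rewrite /= bt ?mem_head //; congr (_ :: _).
    have -> : map b (drop a E) = map (reshape_index lam) (map val (drop a E)).
      by rewrite -map_comp.
    rewrite vd -[a in iota a k]addn0 iotaDl -map_comp -[1%N]/(1 + 0)%N iotaDl.
    apply/eq_in_map => j; rewrite mem_iota add0n => /= ltj.
    by rewrite lamE reshape_hook_tail.
  by rewrite iota_uniq.
rewrite /psum (big_rem (drop a E ++ take a E)) /=; last first.
  by rewrite mem_permutations perm_catC cat_take_drop.
rewrite term1 ltr_pwDl // sumr_ge0 // => s _.
by rewrite cycle_term_blocks ler0n.
Qed.

End Blocks.

(** * Monomial immanants of hooks *)

Lemma psum_map (V : nmodType) (I J : eqType) (f : I -> J) (L : seq I) (F : seq J -> V) :
  injective f -> uniq L -> psum (map f L) F = psum L (F \o map f).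
Proof.
move=> f_inj uL; rewrite /psum -(big_map (map f) predT F); apply: perm_big.
have ufL : uniq (map f L) by rewrite map_inj_uniq.
have um : uniq (map (map f) (permutations L)).
  by rewrite map_inj_uniq ?permutations_uniq //; apply: inj_map.
have [||_ eqm] := @uniq_min_size _ (map (map f) (permutations L)) (permutations (map f L)) um.
- by move=> _ /mapP[s + ->]; rewrite !mem_permutations; apply: perm_map.
- by rewrite size_map !size_permutations // size_map.
by rewrite perm_sym; apply: uniq_perm => //; apply: permutations_uniq.
Qed.

Lemma cycle_term_map (R : comNzRingType) (I J : eqType) (x0 : I) (y0 : J)
    (B : J -> J -> R) (f : I -> J) k s :
  cycle_term y0 B k (map f s) = cycle_term x0 (fun x y => B (f x) (f y)) k s.
Proof.
rewrite /cycle_term -map_drop -map_take; case: (drop k s) => //= y p.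
by rewrite last_map -path_weight_map -(minor_map x0 y0 f f).
Qed.

Lemma cycle_term_ext (R : comNzRingType) (I : eqType) (x0 : I) (B C : I -> I -> R) k s :
  B =2 C -> cycle_term x0 B k s = cycle_term x0 C k s.
Proof.
rewrite /cycle_term => eqBC; case: (drop k s) => // y p; congr (_ * _).
  exact: path_weight_ext.
exact: minor_ext.
Qed.

(** The matrix is moved to the positive integers, 0 being reserved for the root,
    and continued by zero. *)
Lemma psum_cycle_matrix_ge0 (R : realType) (n' k : nat) (A : 'M[R]_n'.+1) :
  (k < n'.+1)%N -> TP k.+1 A -> 0 <= psum (enum 'I_n'.+1) (cycle_term ord0 A k).
Proof.
set n := n'.+1 => ltk hA.
pose ok i := (0 < i <= n)%N.
pose g i : 'I_n := inord i.-1.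
pose B i j : R := if ok i && ok j then A (g i) (g j) else 0.
pose f (i : 'I_n) := i.+1.
have okf i : ok (f i) by rewrite /ok /f ltn_ord.
have gf i : g (f i) = i by rewrite /g /f inord_val.
have f_inj : injective f by move=> i j [] /val_inj.
have -> : psum (enum 'I_n) (cycle_term ord0 A k) =
    psum (map f (enum 'I_n)) (cycle_term 0%N B k).
  rewrite [RHS]psum_map ?enum_uniq //; apply: eq_psum => s _ /=.
  rewrite (cycle_term_map ord0); apply: cycle_term_ext => x y.
  by rewrite /B !okf !gf.
apply: (@psum_cycle_ge0 _ _ _ 0) => //.
- by rewrite map_inj_uniq ?enum_uniq.
- by apply/allP=> _ /mapP[i _ ->].
- by rewrite size_map size_enum_ord.
move=> X Z hX hZ szZ szX.
have [okX|] := boolP (all ok X); last first.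
  case/allPn=> x xX nok; rewrite (minor_row0 _ (x := x)) // => z _.
  by rewrite /B (negPf nok).
have [okZ|] := boolP (all ok Z); last first.
  case/allPn=> z zZ nok; rewrite (minor_col0 _ (z := z)) // => x _.
  by rewrite /B (negPf nok) andbF.
have homo_g (Y : seq nat) : path ltn 0 Y -> all ok Y -> size Y = size X ->
    {homo (fun i : 'I_(size X) => g (nth 0%N Y i)) : i j / (i < j)%N}.
  move=> hY okY szY i j ltij.
  have oky (l : 'I_(size X)) : ok (nth 0%N Y l) by apply: (allP okY); rewrite mem_nth ?szY.
  have := sorted_ltn_nth ltn_trans 0%N (path_sorted hY) i j.
  rewrite !inE szY !ltn_ord => /(_ isT isT ltij).
  have := oky i; have := oky j; rewrite /ok /g => /andP[j0 jn] /andP[i0 i_n] lt.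
  by rewrite !inordK ?prednK // -ltnS !prednK.
have := hA (size X) (fun i => g (nth 0%N X i)) (fun j => g (nth 0%N Z j)) szX
  (homo_g _ hX okX erefl) (homo_g _ hZ okZ szZ).
congr (0 <= \det _); apply/matrixP=> i j; rewrite !mxE /B.
by rewrite (allP okX) ?mem_nth // (allP okZ) ?mem_nth ?szZ.
Qed.

Lemma hook_partition a k : (1 <= a)%N -> is_partition (a + k) (hook a k).
Proof.
move=> a1; rewrite /is_partition /= sumn_nseq mul1n eqxx /= a1 all_nseq orbT andbT /=.
elim: k a a1 => //= k IH a a1; rewrite a1 /=; exact: IH.
Qed.

(** Both sides are class functions with the same sums over all Young subgroups,
    the constant being fixed by the Young subgroup of the hook itself. *)
Lemma hook_function_dual (R : realType) (n' k : nat) (phi : seq nat -> 'S_n'.+1 -> R) :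
  (k < n'.+1)%N -> is_dual_basis phi ->
  exists2 c : R, 0 < c & forall s, hook_function R k s = c * phi (hook (n'.+1 - k) k) s.
Proof.
set n := n'.+1 => ltk [cphi dual]; pose hk := hook (n - k) k.
have hkP : is_partition n hk.
  by have := @hook_partition (n - k) k; rewrite subnK ?subn_gt0 ?(ltnW ltk) //; apply.
pose ysum (lam : seq nat) (f : 'S_n -> R) := \sum_(t in young n lam) f t.
have psi_sum lam : ysum lam (hook_function R k) = psum (enum 'I_n)
    (cycle_term ord0 (\matrix_(i, j) (reshape_index lam i == reshape_index lam j)%:R) k).
  by rewrite -immanant_hook_function // immanant_blocks.
have psi_gt0 : 0 < ysum hk (hook_function R k).
  by rewrite psi_sum hook_blocks_gt0.
have psi_eq0 lam : is_partition n lam -> lam != hk -> ysum lam (hook_function R k) = 0.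
  move=> hlam ne; rewrite psi_sum /psum big_seq big1 // => s; rewrite mem_permutations => sE.
  by apply: contraNeq ne => /(cycle_term_blocks_hook ltk hlam sE) ->.
have phi_sum lam : is_partition n lam ->
    ysum lam (phi hk) = #|young n lam|%:R * (hk == lam)%:R.
  move=> hlam; rewrite -(dual _ _ hkP hlam) inner_eta; last exact: cphi.
  by rewrite mulVKf // pnatr_eq0 -lt0n cardG_gt0.
pose c := ysum hk (hook_function R k) / #|young n hk|%:R.
have H_gt0 : 0 < #|young n hk|%:R :> R by rewrite ltr0n cardG_gt0.
exists c; first by rewrite divr_gt0.
move=> s; apply/eqP; rewrite -subr_eq0; apply/eqP.
apply: (class_function_eq0 (f := fun s => hook_function R k s - c * phi hk s)).
  by move=> u t; rewrite hook_function_class cphi.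
move=> lam hlam; rewrite sumrB -mulr_sumr -/(ysum _ _) -/(ysum _ _) phi_sum //.
have [<-|ne] := eqVneq hk lam; first by rewrite mulr1 divfK ?subrr // gt_eqF.
by rewrite psi_eq0 1?eq_sym // !mulr0 subrr.
Qed.

Theorem theorem1p2 (R : realType) (a k n : nat) (ha : (1 <= a)%N)
    (hn : n = (a + k)%N) (phi : seq nat -> 'S_n -> R)
    (hphi : is_dual_basis phi) (A : 'M[R]_n) (hA : TP k.+1 A) :
  0 <= immanant (phi (hook a k)) A.
Proof.
case: n hn phi hphi A hA => [|n'] hn phi hphi A hA; first by lia.
have ltk : (k < n'.+1)%N by lia.
have [c c_gt0 eqc] := hook_function_dual ltk hphi.
have -> : a = (n'.+1 - k)%N by lia.
rewrite -(pmulr_rge0 _ c_gt0).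
have -> : c * immanant (phi (hook (n'.+1 - k) k)) A = immanant (hook_function R k) A.
  by rewrite /immanant mulr_sumr; apply: eq_bigr => s _; rewrite eqc mulrA.
by rewrite immanant_hook_function // psum_cycle_matrix_ge0.
Qed.
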